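(* Any algorithm $\mathcal{A}$ for the $\mathsf{LOCAL}$ model taking time $T$ and energy $E$ can be simulated (with high probability) in the randomized $\mathsf{No}\text{-}\mathsf{CD}$ model using $O(\Delta^2 T+\Delta\log\Delta\log n)$ time and $O(\Delta(E+\log\Delta\log n))$ energy. This holds even when $\mathcal{A}$ is full-duplex (vertices may transmit and listen in the same slot), while in the simulation simultaneous transmission and reception are not allowed.
   Context: Radio network model: the network is a connected undirected graph $G=(V,E)$ with $n=|V|$ and maximum degree $\Delta$, both known to all vertices. Time is divided into synchronized slots; in each slot a vertex transmits, listens, or is idle. Transmitting or listening costs one unit of energy, idling is free; time is the number of slots and energy the maximum over vertices of the number of transmit/listen slots. In $\mathsf{LOCAL}$, a listener receives every message sent by its neighbors in that slot. In $\mathsf{No}\text{-}\mathsf{CD}$, a listener receives a message only if exactly one neighbor transmits; otherwise it hears silence. Randomized algorithms have private random bits; ''with high probability'' means failure probability at most $1/\mathrm{poly}(n)$. *)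

(* Defs.v *)
From mathcomp Require Import all_boot.
Set Implicit Arguments.
Unset Strict Implicit.
Unset Printing Implicit Defensive.

Definition simple_graph (V : finType) (adj : rel V) : Prop :=
  symmetric adj /\ irreflexive adj.

Definition graph_connected (V : finType) (adj : rel V) : Prop :=
  forall u v : V, connect adj u v.

Definition max_degree (V : finType) (adj : rel V) : nat :=
  \max_(v : V) #|[set u | adj v u]|.

Definition log2 (x : nat) : nat := trunc_log 2 x.

(* LOCAL model, full duplex.  An algorithm is run identically by every *)
(* vertex; its behaviour depends only on the vertex's local input      *)
(* (of type I: e.g. identifier, random string, problem input) and on   *)
(* what it hears.  In slot t a vertex in state s performs the action   *)
(* [l_act t s] = (transmitted message, listens?) -- full duplex: both  *)
(* may happen in the same slot.  A listener receives the multiset of   *)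
(* messages sent by its transmitting neighbours ([Some l]); a          *)
(* non-listener receives nothing ([None]).                             *)

Record local_alg (I S : Type) (M : eqType) := LocalAlg {
  l_init : I -> S;
  l_act  : nat -> S -> option M * bool;
  l_upd  : nat -> S -> option (seq M) -> S
}.
Arguments l_init {I S M}. Arguments l_act {I S M}. Arguments l_upd {I S M}.

(* received messages form a multiset: the update may not depend on the
   order in which they are listed *)
Definition local_alg_wf (I S : Type) (M : eqType) (A : local_alg I S M) : Prop :=
  forall t s l l', perm_eq l l' -> l_upd A t s (Some l) = l_upd A t s (Some l').

Definition l_active (M : Type) (a : option M * bool) : bool :=
  isSome a.1 || a.2.

Section LocalExec.
Variables (V : finType) (adj : rel V) (I S : Type) (M : eqType).
Variables (A : local_alg I S M) (inp : V -> I).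

Definition local_received (st : V -> S) (t : nat) (v : V) : option (seq M) :=
  if (l_act A t (st v)).2 then
    Some (pmap (fun u => if adj v u then (l_act A t (st u)).1 else None) (enum V))
  else None.

Fixpoint local_state (t : nat) : V -> S :=
  match t with
  | 0 => fun v => l_init A (inp v)
  | t'.+1 => let st := local_state t' in
             fun v => l_upd A t' (st v) (local_received st t' v)
  end.

Definition local_energy (T : nat) : nat :=
  \max_(v : V) count (fun t => l_active (l_act A t (local_state t v))) (iota 0 T).

End LocalExec.

(* Randomized No-CD model, half duplex: in each slot a vertex idles,   *)
(* transmits a message, or listens (never both).  A listener receives  *)
(* m iff exactly one neighbour transmits (and it transmits m);         *)
(* otherwise it hears silence ([None]).  Each vertex has private       *)
(* random bits: [b_rbits] independent uniform bits per vertex, drawn    *)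
(* at the start.  The algorithm runs for [b_len] slots and then every  *)
(* vertex outputs [b_out] of its state.                                *)

Inductive nocd_action (M : Type) := NIdle | NTransmit of M | NListen.
Arguments NIdle {M}.
Arguments NListen {M}.

Definition n_tx (M : Type) (a : nocd_action M) : option M :=
  if a is NTransmit m then Some m else None.

Definition n_active (M : Type) (a : nocd_action M) : bool :=
  if a is NIdle then false else true.

Record nocd_alg (I O : Type) := NocdAlg {
  b_state : Type;
  b_msg   : Type;
  b_rbits : nat;
  b_len   : nat;
  b_init  : I -> {ffun 'I_b_rbits -> bool} -> b_state;
  b_act   : nat -> b_state -> nocd_action b_msg;
  b_upd   : nat -> b_state -> option b_msg -> b_state;
  b_out   : b_state -> O
}.
Arguments b_state {I O}. Arguments b_msg {I O}. Arguments b_rbits {I O}.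
Arguments b_len {I O}. Arguments b_init {I O}. Arguments b_act {I O}.
Arguments b_upd {I O}. Arguments b_out {I O}.

Section NocdExec.
Variables (V : finType) (adj : rel V) (I O : Type) (B : nocd_alg I O).
Variables (inp : V -> I) (rnd : {ffun V -> {ffun 'I_(b_rbits B) -> bool}}).

Definition nocd_received (st : V -> b_state B) (t : nat) (v : V)
  : option (b_msg B) :=
  if b_act B t (st v) is NListen then
    match pmap (fun u => if adj v u then n_tx (b_act B t (st u)) else None)
               (enum V) with
    | [:: m] => Some m
    | _ => None
    end
  else None.

Fixpoint nocd_state (t : nat) : V -> b_state B :=
  match t with
  | 0 => fun v => b_init B (inp v) (rnd v)
  | t'.+1 => let st := nocd_state t' in
             fun v => b_upd B t' (st v) (nocd_received st t' v)
  end.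

Definition nocd_is_active (t : nat) (v : V) : bool :=
  n_active (b_act B t (nocd_state t v)).

Definition nocd_output (v : V) : O := b_out B (nocd_state (b_len B) v).

Definition nocd_energy : nat :=
  \max_(v : V) count (fun t => nocd_is_active t v) (iota 0 (b_len B)).

(* time: number of slots up to (and including) the last slot in which
   some vertex is active; after it nothing can be communicated, and
   local computation is free *)
Definition nocd_time : nat :=
  \max_(v : V) \max_(t < b_len B | nocd_is_active t v) t.+1.

End NocdExec.

(* "with probability at least 1 - 1/n^k over the private random bits":
   there is a set of random assignments of failure mass <= 1/n^k on
   all of which the property holds. *)
Definition whp (V : finType) (R : nat) (n k : nat)
  (P : {ffun V -> {ffun 'I_R -> bool}} -> Prop) : Prop :=
  exists G : {set {ffun V -> {ffun 'I_R -> bool}}},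
    #|~: G| * n ^ k <= #|{: {ffun V -> {ffun 'I_R -> bool}}}|
    /\ forall r, r \in G -> P r.

(* Main.v *)
Require Import Defs.
From mathcomp Require Import all_boot zify.
Set Implicit Arguments.
Unset Strict Implicit.
Unset Printing Implicit Defensive.

(* Once the vertices have a proper distance-2 colouring with O(Delta^2)      *)
(* colours and know the colours of their neighbours, a LOCAL slot becomes a  *)
(* block with one slot per colour: a transmitter uses the slot of its        *)
(* colour, a listener those of its at most Delta neighbours.                 *)
(*   For Delta >= 2 the colouring is found by letting every vertex transmit  *)
(* in each slot with probability 2^-a of order 1/Delta, and listen otherwise, *)
(* so that a given edge is served with probability of order 1/Delta.  Hence  *)
(* O(Delta log n) slots tell everybody the identifiers (random strings) of   *)
(* its neighbours, and O(Delta log Delta) slots are enough for one trial:    *)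
(* unfixed vertices draw a colour and keep it if each neighbour acknowledges *)
(* that it has heard all of its own neighbours and saw no conflict.  The     *)
(* acknowledgements make a kept colour always correct, and whatever happened *)
(* before, a trial succeeds with probability at least 1/2; O(log n) trials   *)
(* suffice.  For Delta = 1 there are at most two vertices, and a random      *)
(* colour of k + 2 bits will do; for Delta = 0 nothing needs to be sent.     *)

(** * Counting over the random bits *)

(** With a distance-2 colouring known to neighbours, at most one neighbour of a listener transmits
    in the slot of a given colour. A block of [#|K|] slots thus delivers the multiset of one LOCAL
    slot ([sim_block_state]), and an active vertex is awake in at most Delta + 1 of them
    ([sim_energy]). The additive terms of the bounds are the length of the colouring phase, during
    which no vertex sleeps.

    That kept colours are correct is deterministic ([abs_fixed_inj]); only termination is random.
    Who hears whom depends on the transmission bits alone, so the trials are idealised as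
    [abs_fixed], a function of the bits that makes sense even if identifiers collide or are not
    learned. The probabilistic analysis is done on this function ([card_unfixed]), and [fixed_trial]
    shows that the real run follows it when identifiers are distinct and learned.

    Probability is counting of bit assignments: [card_resample] conditions on part of the bits and
    [card_stages] multiplies conditional bounds. A neighbour is heard in a slot with probability at
    least 2^-(a+1) ([card_hears]), hence missed in a round with probability at most 2^-b
    ([card_not_heard]); a union bound yields [card_trial_fails]. Four bad events of probability at
    most n^2 / 2^L remain ([card_colouring_fails]), and L is chosen with 2^L >= 4 n^(k+2). *)

Section Sampling.
Variables (V : finType) (R : nat).
Local Notation Omega := {ffun V -> {ffun 'I_R -> bool}}.
Implicit Types (D : V -> 'I_R -> bool) (x y : Omega).

Definition resample D x y : Omega :=
  [ffun v => [ffun i => if D v i then y v i else x v i]].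

Lemma resampleE D x y v i :
  resample D x y v i = if D v i then y v i else x v i.
Proof. by rewrite !ffunE. Qed.

(** Exchanging the [D]-bits of [x] and [y] is an involution on pairs, so [resample D x y] is uniform
    for independent uniform [x] and [y]. *)
Lemma sum_resample D (F : Omega -> nat) :
  \sum_x \sum_y F (resample D x y) = #|{: Omega}| * \sum_x F x.
Proof.
pose swap (p : Omega * Omega) := (resample D p.1 p.2, resample D p.2 p.1).
have swapK : involutive swap.
  by case=> x y; congr (_, _); apply/ffunP=> v; apply/ffunP=> i;
    rewrite !resampleE; case: (D v i).
rewrite pair_bigA /= (reindex_inj (inv_inj swapK)) /=.
rewrite (eq_bigr (fun p : Omega * Omega => F p.1)) => [|[x y] _ /=]; last first.
  congr F; apply/ffunP=> v; apply/ffunP=> i.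
  by rewrite !resampleE; case: (D v i).
rewrite -(pair_bigA _ (fun x (_ : Omega) => F x)) /= big_distrr /=.
by apply: eq_bigr => x _; rewrite sum_nat_const.
Qed.

Lemma card_sum1 (P : pred Omega) : #|[set x | P x]| = \sum_x P x.
Proof.
by rewrite -sum1_card big_mkcond; apply: eq_bigr => x _; rewrite inE; case: (P x).
Qed.

(* A bound [p / q] on the conditional probability of [P] given the bits      *)
(* outside [D], where that probability is 0 outside [Q].                     *)
Lemma card_resample D (P Q : pred Omega) (p q : nat) :
  (forall x, #|[set y | P (resample D x y)]| * q <= Q x * (p * #|{: Omega}|)) ->
  #|[set x | P x]| * q <= p * #|[set x | Q x]|.
Proof.
move=> H.
have cO : 0 < #|{: Omega}| by apply/card_gt0P; exists [ffun=> [ffun=> false]].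
rewrite -(leq_pmul2l cO) mulnA card_sum1 -(sum_resample D) big_distrl /=.
have -> : #|{: Omega}| * (p * #|[set x | Q x]|)
          = \sum_x Q x * (p * #|{: Omega}|).
  by rewrite card_sum1 -big_distrl /= mulnA mulnC (mulnC p).
by apply: leq_sum => x _; rewrite -card_sum1.
Qed.

Lemma card_resample1 D (P : pred Omega) (p q : nat) :
  (forall x, #|[set y | P (resample D x y)]| * q <= p * #|{: Omega}|) ->
  #|[set x | P x]| * q <= p * #|{: Omega}|.
Proof.
move=> H; rewrite -[X in _ <= p * X]cardsT.
rewrite (_ : [set: Omega] = [set x | predT x]); last by apply/setP=> x; rewrite !inE.
by apply: (card_resample (D := D)) => x; rewrite mul1n.
Qed.

(** Stage [j] owns the bits [D j]. Event [bad i] may depend on earlier stages but not on later ones,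
    so whatever the earlier stages gave, the last one fails with conditional probability at most
    [p / q]. *)
Lemma card_stages (D : nat -> V -> 'I_R -> bool) (bad : nat -> pred Omega)
    (p q m : nat) :
  (forall i j x y, i < j < m -> bad i (resample (D j) x y) = bad i x) ->
  (forall i x, i < m ->
     #|[set y | bad i (resample (D i) x y)]| * q <= p * #|{: Omega}|) ->
  #|[set x | [forall i : 'I_m, bad i x]]| * q ^ m <= p ^ m * #|{: Omega}|.
Proof.
elim: m => [|m IH] indep le_bad; first by rewrite !expn0 muln1 mul1n max_card.
have {}IH : #|[set x | [forall i : 'I_m, bad i x]]| * q ^ m
            <= p ^ m * #|{: Omega}|.
  apply: IH => [i j x y /andP[ij jm]|i x im]; last by apply: le_bad; apply: ltnW.
  by apply: indep; rewrite ij ltnW.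
have step : #|[set x | [forall i : 'I_m.+1, bad i x]]| * q
            <= p * #|[set x | [forall i : 'I_m, bad i x]]|.
  apply: (card_resample (D := D m)) => x.
  have [/forallP Hx|Hx] := boolP [forall i : 'I_m, bad i x].
    rewrite mul1n; apply: leq_trans (le_bad m x (leqnn _)).
    rewrite leq_mul2r; apply/orP; right; apply/subset_leq_card/subsetP=> y.
    by rewrite !inE => /forallP/(_ ord_max).
  rewrite mul0n leqn0 muln_eq0 cards_eq0; apply/orP; left.
  apply/eqP/setP=> y; rewrite !inE; apply: contraNF Hx => /forallP H.
  apply/forallP=> i; have := H (widen_ord (leqnSn m) i) => /=.
  by rewrite indep // ltn_ord ltnSn.
rewrite !expnS mulnA.
apply: leq_trans (leq_mul step (leqnn _)) _.
by rewrite -!mulnA leq_mul2l IH orbT.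
Qed.

Lemma card_prescribed D (w : V -> 'I_R -> bool) :
  #|[set y : Omega | [forall v, [forall i, D v i ==> (y v i == w v i)]]]|
    * 2 ^ (\sum_v \sum_i D v i) = #|{: Omega}|.
Proof.
pose F v i : pred bool := if D v i then pred1 (w v i) else predT.
have -> : #|[set y : Omega | [forall v, [forall i, D v i ==> (y v i == w v i)]]]|
          = #|(family (fun v => family (F v)) : pred Omega)|.
  apply: eq_card => y; rewrite inE; apply/forallP/familyP => H v.
    apply/familyP=> i; move/forallP: (H v) => /(_ i).
    by rewrite /F; case: (D v i).
  apply/forallP=> i; move/familyP: (H v) => /(_ i).
  by rewrite /F; case: (D v i).
rewrite card_family foldrE big_map big_enum /=.
rewrite -[RHS](_ : \prod_(v : V) \prod_(i < R) 2 = _); last first.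
  by rewrite !prod_nat_const card_ffun card_ffun card_bool card_ord.
rewrite expn_sum -big_split /=; apply: eq_bigr => v _.
rewrite card_family foldrE big_map big_enum /= expn_sum -big_split /=.
apply: eq_bigr => i _; rewrite /F; case: (D v i); first by rewrite card1.
by rewrite muln1 -card_bool; apply: eq_card.
Qed.
Lemma card_bits (U : {set V}) c (f : 'I_c -> 'I_R) (w : V -> 'I_c -> bool) :
  injective f ->
  #|[set y : Omega | [forall (u | u \in U), [forall i, y u (f i) == w u i]]]|
    * 2 ^ (#|U| * c) = #|{: Omega}|.
Proof.
move=> f_inj; pose D v j := (v \in U) && (j \in codom f).
pose w' v j := if [pick i | f i == j] is Some i then w v i else false.
rewrite -(card_prescribed D w'); congr (_ * 2 ^ _).
  apply: eq_card => y; rewrite !inE; apply/forall_inP/forallP => H u.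
    apply/forallP=> j; apply/implyP=> /andP[uU /codomP[i ->]].
    rewrite /w'; case: pickP => [i' /eqP/f_inj ->|/(_ i)]; last by rewrite eqxx.
    by have /forallP := H u uU.
  move=> uU; apply/forallP=> i.
  have /forallP/(_ (f i)) := H u; rewrite /D uU codom_f /w' /=.
  case: pickP => [i' /eqP/f_inj -> //|/(_ i)]; by rewrite eqxx.
rewrite (bigID (mem U)) /= [X in _ = _ + X]big1 ?addn0; last first.
  by move=> v /negPf vU; rewrite big1 // => j _; rewrite /D vU.
rewrite -sum_nat_const; apply: eq_bigr => v vU.
rewrite -[LHS](card_ord c) -(card_codom f_inj) -sum1_card big_mkcond /=.
by apply: eq_bigr => j _; rewrite /D vU; case: (_ \in _).
Qed.

Lemma card_exists (T : finType) (A : pred T) (P : T -> pred Omega) q N :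
  (forall t, A t -> #|[set x | P t x]| * q <= N) ->
  #|[set x | [exists (t | A t), P t x]]| * q <= #|A| * N.
Proof.
move=> leN; have leP x : [exists (t | A t), P t x] <= \sum_(t | A t) P t x.
  case: exists_inP => // -[t At Pt]; rewrite (bigD1 t) //= Pt.
  exact: leq_addr.
have -> : #|A| * N = \sum_(t | A t) N by rewrite sum_nat_const.
apply: leq_trans (leq_sum _ leN).
rewrite -big_distrl /= leq_mul2r; apply/orP; right.
under [X in _ <= X]eq_bigr => t _ do rewrite card_sum1.
by rewrite card_sum1 exchange_big /=; apply: leq_sum.
Qed.

Lemma card_or (P Q : pred Omega) q M N :
  #|[set x | P x]| * q <= M -> #|[set x | Q x]| * q <= N ->
  #|[set x | P x || Q x]| * q <= M + N.
Proof.
move=> leM leN; apply: leq_trans (leq_add leM leN).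
rewrite -mulnDl leq_mul2r; apply/orP; right.
rewrite (_ : [set x | P x || Q x] = [set x | P x] :|: [set x | Q x]).
  exact: leq_card_setU.
by apply/setP=> x; rewrite !inE.
Qed.

Lemma card_subpred (P Q : pred Omega) q M :
  (forall x, P x -> Q x) ->
  #|[set x | Q x]| * q <= M -> #|[set x | P x]| * q <= M.
Proof.
move=> PQ; apply: leq_trans; rewrite leq_mul2r; apply/orP; right.
by apply/subset_leq_card/subsetP=> x; rewrite !inE; apply: PQ.
Qed.

Lemma card_non_injective :
  #|[set x : Omega | ~~ injectiveb x]| * 2 ^ R <= #|V| ^ 2 * #|{: Omega}|.
Proof.
apply: (@card_subpred _ (fun x : Omega => [exists (p | p.1 != p.2), x p.1 == x p.2])).
  move=> x /injectivePn[u [v neq eq_uv]].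
  by apply/exists_inP; exists (u, v); rewrite //= eq_uv.
apply: leq_trans (card_exists (N := #|{: Omega}|) _) _; last first.
  by rewrite leq_mul2r -mulnn -card_prod max_card orbT.
case=> u v /= neq; rewrite -[X in _ <= X]mul1n.
apply: (card_resample1 (D := fun w _ => w == v)) => x.
rewrite mul1n -(card_bits [set v] (fun _ i => x u i) (@inj_id _)) cards1 mul1n.
rewrite leq_mul2r; apply/orP; right; apply/subset_leq_card/subsetP=> y.
rewrite !inE => /eqP/ffunP eq_uv; apply/forall_inP=> w; rewrite inE => /eqP ->.
apply/forallP=> i; have := eq_uv i; rewrite !resampleE eqxx (negPf neq) => ->.
exact: eqxx.
Qed.
End Sampling.

(** This is (1 - 1/(h+1))^(h+1) <= 1/2, from the Bernoulli inequality (1 + 1/h)^m >= 1 + m/h at m =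
    h + 1. *)
Lemma pow_pred_half h : 0 < h -> 2 * h ^ h.+1 <= h.+1 ^ h.+1.
Proof.
move=> h_gt0.
have bernoulli m : (h + m) * h ^ m <= h * h.+1 ^ m.
  elim: m => [|m IH]; first by rewrite addn0.
  rewrite !expnS (mulnCA h h.+1).
  apply: leq_trans (leq_mul (leqnn h.+1) IH).
  rewrite !mulnA leq_mul2r; apply/orP; right.
  by rewrite addnS !mulSn (mulnC h) leq_add2r leq_addr.
rewrite -(leq_pmul2l h_gt0); apply: leq_trans (bernoulli h.+1).
by rewrite mulnA leq_mul2r muln2 -addnn leq_add2l leqnSn orbT.
Qed.

(** * Block algorithms and sequential composition *)

(** Reception as a function of the actions in one slot only, so that runs with different state types
    can be compared. *)
Definition nocd_recv (V : finType) (adj : rel V) (M : Type)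
    (act : V -> nocd_action M) (v : V) : option M :=
  if act v is NListen then
    if pmap (fun u => if adj v u then n_tx (act u) else None) (enum V)
       is [:: m] then Some m else None
  else None.

Lemma eq_nocd_recv (V : finType) (adj : rel V) (M : Type)
    (act act' : V -> nocd_action M) v :
  act =1 act' -> nocd_recv adj act v = nocd_recv adj act' v.
Proof.
move=> eq_act; rewrite /nocd_recv eq_act.
by under eq_pmap => u do rewrite eq_act.
Qed.

Lemma nocd_receivedE (V : finType) (adj : rel V) (I O : Type)
    (B : nocd_alg I O) (st : V -> b_state B) t v :
  nocd_received adj st t v = nocd_recv adj (fun u => b_act B t (st u)) v.
Proof.
by rewrite /nocd_received /nocd_recv; case: (b_act B t (st v)).
Qed.

Lemma nocd_time_le (V : finType) (adj : rel V) (I O : Type)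
    (B : nocd_alg I O) inp (rnd : {ffun V -> {ffun 'I_(b_rbits B) -> bool}}) :
  nocd_time adj inp rnd <= b_len B.
Proof. by apply/bigmax_leqP => v _; apply/bigmax_leqP => t _. Qed.

Section Block.
Variables (I O S M : Type) (P T R : nat).
Variables (init : I -> {ffun 'I_R -> bool} -> S).
Variables (act : nat -> nat -> S -> nocd_action M).
Variables (upd : nat -> S -> seq (option M) -> S) (out : S -> O).

(* The state only changes at the end of a block of [P] slots, when [upd] is *)
(* given the list of what was received in the [P] slots of the block.       *)
Definition block_alg : nocd_alg I O :=
  @NocdAlg I O (S * seq (option M))%type M R (T * P)
    (fun i x => (init i x, [::]))
    (fun t s => act (t %/ P) (t %% P) s.1)
    (fun t s o => let l := rcons s.2 o in
       if (t %% P).+1 == P then (upd (t %/ P) s.1 l, [::]) else (s.1, l))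
    (fun s => out s.1).

Variables (V : finType) (adj : rel V) (inp : V -> I).
Variable rnd : {ffun V -> {ffun 'I_R -> bool}}.

Fixpoint block_state (b : nat) : V -> S :=
  if b is b'.+1 then fun v =>
    upd b' (block_state b' v)
      [seq nocd_recv adj (fun u => act b' c (block_state b' u)) v
         | c <- iota 0 P]
  else fun v => init (inp v) (rnd v).

Lemma block_stateS b v : block_state b.+1 v =
  upd b (block_state b v)
    [seq nocd_recv adj (fun u => act b c (block_state b u)) v | c <- iota 0 P].
Proof. by []. Qed.

Hypothesis P_gt0 : 0 < P.

Lemma nocd_state_block t v :
  nocd_state (B := block_alg) adj inp rnd t v =
  (block_state (t %/ P) v,
   [seq nocd_recv adj (fun u => act (t %/ P) c (block_state (t %/ P) u)) v
      | c <- iota 0 (t %% P)]).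
Proof.
elim: t v => [|t IH] v; first by rewrite div0n mod0n.
have eq_recv : nocd_received (B := block_alg) adj
      (nocd_state (B := block_alg) adj inp rnd t) t v =
    nocd_recv adj (fun u => act (t %/ P) (t %% P) (block_state (t %/ P) u)) v.
  by rewrite nocd_receivedE; apply: eq_nocd_recv => u; rewrite IH.
have ltP := ltn_pmod t P_gt0.
have dt : t.+1 = t %/ P * P + (t %% P).+1 by rewrite addnS -divn_eq.
have rconsE (f : nat -> option M) n :
    rcons [seq f c | c <- iota 0 n] (f n) = [seq f c | c <- iota 0 n.+1].
  by rewrite -[in RHS]addn1 iotaD map_cat cats1.
rewrite [LHS]/= eq_recv IH /=.
rewrite (rconsE (fun c =>
  nocd_recv adj (fun u => act (t %/ P) c (block_state (t %/ P) u)) v)).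
case: eqP => [eqP|/eqP neP].
  have -> : t.+1 %/ P = (t %/ P).+1.
    by rewrite dt eqP -mulSnr mulnK.
  have -> : t.+1 %% P = 0 by rewrite dt eqP -mulSnr modnMl.
  by rewrite eqP.
have ltP' : (t %% P).+1 < P by rewrite ltn_neqAle neP.
have -> : t.+1 %/ P = t %/ P by rewrite {1}dt divnMDl // (divn_small ltP') addn0.
by have -> : t.+1 %% P = (t %% P).+1 by rewrite {1}dt modnMDl modn_small.
Qed.

Lemma nocd_output_block v :
  nocd_output (B := block_alg) adj inp rnd v = out (block_state T v).
Proof. by rewrite /nocd_output nocd_state_block /= mulnK. Qed.

Lemma nocd_is_active_block t v :
  nocd_is_active (B := block_alg) adj inp rnd t v =
  n_active (act (t %/ P) (t %% P) (block_state (t %/ P) v)).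
Proof. by rewrite /nocd_is_active nocd_state_block. Qed.

End Block.
Arguments block_state : simpl never.

Section Seq.
Variables (I O1 O : Type) (B0 : nocd_alg unit O1) (B1 : nocd_alg (I * O1) O).

(** [None] in the last component means that the second phase has not begun; [seq_cur] then starts
    [B1] from the output of [B0]. All random bits go to [B0]; [B1] is meant to be deterministic and
    is started on constant bits. *)
Definition seq_state := (I * b_state B0 * option (b_state B1))%type.
Definition seq_cur (s : seq_state) : b_state B1 :=
  odflt (b_init B1 (s.1.1, b_out B0 s.1.2) [ffun=> false]) s.2.

Definition map_action (M M' : Type) (f : M -> M') (a : nocd_action M) :=
  match a with
  | NIdle => NIdle
  | NTransmit m => NTransmit (f m)
  | NListen => NListen
  end.

Definition seq_alg : nocd_alg I O :=
  @NocdAlg I O seq_state (b_msg B0 + b_msg B1)%type (b_rbits B0)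
    (b_len B0 + b_len B1)
    (fun i x => (i, b_init B0 tt x, None))
    (fun t s => if t < b_len B0 then map_action inl (b_act B0 t s.1.2)
                else map_action inr (b_act B1 (t - b_len B0) (seq_cur s)))
    (fun t s o =>
       if t < b_len B0 then
         (s.1.1, b_upd B0 t s.1.2 (if o is Some (inl m) then Some m else None),
          None)
       else (s.1, Some (b_upd B1 (t - b_len B0) (seq_cur s)
                        (if o is Some (inr m) then Some m else None))))
    (fun s => b_out B1 (seq_cur s)).

Variables (V : finType) (adj : rel V) (inp : V -> I).
Variable rnd : {ffun V -> {ffun 'I_(b_rbits B0) -> bool}}.

Lemma nocd_recv_map (M M' : Type) (f : M -> M') (act : V -> nocd_action M) v :
  nocd_recv adj (fun u => map_action f (act u)) v
  = omap f (nocd_recv adj act v).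
Proof.
rewrite /nocd_recv; case: (act v) => //=.
rewrite (_ : pmap _ _ = map f
  (pmap (fun u => if adj v u then n_tx (act u) else None) (enum V))).
  by case: (pmap _ _) => [|? []].
elim: (enum V) => //= u s ->; case: (adj v u) => //=; by case: (act u).
Qed.

Let out1 v := nocd_output (B := B0) adj (fun=> tt) rnd v.
Let inp1 v := (inp v, out1 v).
Let rnd1 : {ffun V -> {ffun 'I_(b_rbits B1) -> bool}} :=
  [ffun=> [ffun=> false]].

Lemma nocd_state_seq1 t v : t <= b_len B0 ->
  nocd_state (B := seq_alg) adj inp rnd t v =
  (inp v, nocd_state (B := B0) adj (fun=> tt) rnd t v, None).
Proof.
elim: t v => [|t IH] v //= lt_t.
rewrite nocd_receivedE /= lt_t IH; last exact: ltnW.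
rewrite (@eq_nocd_recv _ _ _ _ (fun u =>
  map_action inl (b_act B0 t (nocd_state (B := B0) adj (fun=> tt) rnd t u)))).
  by rewrite nocd_recv_map nocd_receivedE; case: (nocd_recv _ _ _).
by move=> u; rewrite IH // ltnW.
Qed.

Lemma nocd_state_seq2 t v :
  let s := nocd_state (B := seq_alg) adj inp rnd (b_len B0 + t) v in
  seq_cur s = nocd_state (B := B1) adj inp1 rnd1 t v.
Proof.
elim: t v => [|t IH] v /=.
  by rewrite addn0 nocd_state_seq1 // /seq_cur /= ffunE.
rewrite addnS /= ltnNge leq_addr /= addKn {1}/seq_cur /=.
rewrite !nocd_receivedE IH; congr (b_upd _ _ _ _).
rewrite (@eq_nocd_recv _ _ _ _ (fun u =>
  map_action inr (b_act B1 t (nocd_state (B := B1) adj inp1 rnd1 t u)))).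
  by rewrite nocd_recv_map; case: (nocd_recv _ _ _).
by move=> u /=; rewrite ltnNge leq_addr /= addKn IH.
Qed.

Lemma nocd_output_seq v :
  nocd_output (B := seq_alg) adj inp rnd v
  = nocd_output (B := B1) adj inp1 rnd1 v.
Proof. by rewrite {2}/nocd_output -(nocd_state_seq2 (b_len B1)). Qed.

Lemma nocd_energy_seq :
  nocd_energy (B := seq_alg) adj inp rnd
  <= b_len B0 + nocd_energy (B := B1) adj inp1 rnd1.
Proof.
apply/bigmax_leqP => v _; rewrite [b_len seq_alg]/= iotaD count_cat add0n.
apply: leq_add.
  by rewrite -[X in _ <= X](size_iota 0) count_size.
apply: leq_trans (leq_bigmax v).
rewrite -[X in iota X]addn0 iotaDl count_map; apply: sub_count => t /=.
rewrite /nocd_is_active -nocd_state_seq2.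
rewrite [b_act]lock /= -lock /= ltnNge leq_addr /= addKn.
by case: (b_act _ _ _).
Qed.

End Seq.

(** * Simulation from a colouring *)

Lemma count_block (p : nat -> nat -> bool) P T (q : nat -> bool) d :
  0 < P ->
  (forall b, b < T -> count (p b) (iota 0 P) <= q b * d) ->
  count (fun t => p (t %/ P) (t %% P)) (iota 0 (T * P))
    <= count q (iota 0 T) * d.
Proof.
move=> P_gt0; elim: T => // T IH le_d.
rewrite mulSnr -[T.+1]addn1 !iotaD !count_cat /= addn0 mulnDl add0n.
apply: leq_add; first by apply: IH => b bT; apply: le_d; apply: ltnW.
apply: leq_trans (le_d T (leqnn _)).
rewrite -[X in iota X]addn0 iotaDl count_map leq_eqVlt; apply/orP; left.
apply/eqP/eq_in_count => c; rewrite mem_iota add0n => /andP[_ cP] /=.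
by rewrite divnMDl // divn_small // addn0 modnMDl modn_small.
Qed.

Lemma iota_enum_rank (K : finType) :
  iota 0 #|K| = [seq (enum_rank k : nat) | k <- enum K].
Proof.
apply: (@eq_from_nth _ 0); first by rewrite size_iota size_map -cardE.
move=> i; rewrite size_iota => iK; rewrite nth_iota // add0n.
have k0 := enum_val (Ordinal iK).
rewrite (nth_map k0) -?cardE //.
by rewrite -(enum_val_nth k0 (Ordinal iK)) enum_valK.
Qed.

Section Sim.
Variables (I S : Type) (M : eqType) (K : finType) (T : nat).
Variable A : local_alg I S M.

Definition sim_state := (S * (K * {set K}))%type.

(** Full duplex is split over the block: the vertex speaks in the slot of its own colour and listens
    in others, since its colour will not lie in its listening set. *)
Definition sim_act (b c : nat) (s : sim_state) : nocd_action M :=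
  let a := l_act A b s.1 in
  if (if c == enum_rank s.2.1 then a.1 else None) is Some m then NTransmit m
  else if a.2 && [exists k in s.2.2, c == enum_rank k] then NListen else NIdle.

Definition sim_upd (b : nat) (s : sim_state) (l : seq (option M)) : sim_state :=
  (l_upd A b s.1 (if (l_act A b s.1).2 then Some (pmap id l) else None), s.2).

Definition sim_alg : nocd_alg (I * (K * {set K})) S :=
  @block_alg _ _ sim_state M #|K| T 0 (fun i _ => (l_init A i.1, i.2))
    sim_act sim_upd (fun s => s.1).

Variables (V : finType) (adj : rel V) (inp : V -> I) (info : V -> K * {set K}).
Variable rnd : {ffun V -> {ffun 'I_0 -> bool}}.
Hypothesis A_wf : local_alg_wf A.
Let col v := (info v).1.
Let lis v := (info v).2.
Hypothesis lis_nbr : forall v u, adj v u -> col u \in lis v.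
Hypothesis lis_self : forall v, col v \notin lis v.
Hypothesis col_inj : forall v, {in adj v &, injective col}.

Lemma sim_recv b (st : V -> sim_state) v k :
  (forall u, (st u).2 = info u) -> (l_act A b (st v).1).2 ->
  nocd_recv adj (fun u => sim_act b (enum_rank k) (st u)) v =
  if [pick u | adj v u & col u == k] is Some u then (l_act A b (st u).1).1
  else None.
Proof.
move=> st_info lis_v.
have rank_eq (k' : K) : (enum_rank k == enum_rank k' :> nat) = (k == k').
  by rewrite (inj_eq val_inj) (inj_eq enum_rank_inj).
have tx u : n_tx (sim_act b (enum_rank k) (st u)) =
            if k == col u then (l_act A b (st u).1).1 else None.
  rewrite /sim_act st_info rank_eq; case: (if _ then _ else _) => //.
  by case: (_ && _).
rewrite /nocd_recv; under eq_pmap => u do rewrite tx.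
case: pickP => [u /andP[vu /eqP cu]|no_u]; last first.
  rewrite (_ : pmap _ _ = [::]); first by case: (sim_act _ _ _).
  elim: (enum V) => //= u s ->; case: (boolP (adj v u)) => //= vu.
  by have := no_u u; rewrite vu eq_sym /= => ->.
have -> : sim_act b (enum_rank k) (st v) = NListen.
  rewrite /sim_act st_info rank_eq -cu.
  case: eqP => [eq_uv|_].
    by have /negP[] := lis_self v; rewrite /col -eq_uv; apply: lis_nbr vu.
  rewrite lis_v (_ : [exists _ in _, _]) //.
  by apply/existsP; exists (col u); rewrite (lis_nbr vu) eqxx.
have -> : pmap (fun w => if adj v w then
     if k == col w then (l_act A b (st w).1).1 else None else None) (enum V)
  = pmap (fun w => if w == u then (l_act A b (st u).1).1 else None) (enum V).
  apply: eq_pmap => w; have [->|neq] := eqVneq w u; first by rewrite vu cu eqxx.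
  case: ifP => // vw; case: eqP => // cw.
  by case/eqP: neq; apply: (@col_inj v); rewrite ?inE // cu.
have := enum_uniq V; have : u \in enum V by rewrite mem_enum.
elim: (enum V) => //= w s IH; rewrite inE => /orP[/eqP <-|us] /andP[ws uniq_s].
  rewrite eqxx (_ : pmap _ s = [::]) //; first by case: (l_act _ _ _).1.
  elim: s ws {uniq_s IH} => //= w' s IH; rewrite inE negb_or.
  by case/andP=> neq /IH ->; rewrite eq_sym (negPf neq).
have [eq_wu|_] := eqVneq w u; first by rewrite eq_wu us in ws.
by apply: IH.
Qed.

Hypothesis K_gt0 : 0 < #|K|.

Local Notation bstate := (block_state #|K| (fun i _ => (l_init A i.1, i.2))
  sim_act sim_upd adj (fun v => (inp v, info v)) rnd).

(** The block lists messages by colour, the LOCAL slot by vertex. As colours are injective on the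
    neighbours of [v], one list permutes the other, and [A_wf] makes the order immaterial. *)
Lemma sim_block_state b v : bstate b v = (local_state adj A inp b v, info v).
Proof.
elim: b v => // b IH v; rewrite block_stateS.
rewrite /sim_upd IH /=; congr (_, _).
rewrite /local_received; case lis_v : (l_act _ _ _).2; last by [].
apply: A_wf.
pose g u := (l_act A b (local_state adj A inp b u)).1.
pose h k := if [pick u | adj v u & col u == k] is Some u then g u else None.
rewrite iota_enum_rank -map_comp.
have -> : pmap id [seq ((fun c => nocd_recv adj (fun u => sim_act b c (bstate b u)) v)
     \o (fun k : K => enum_rank k : nat)) k | k <- enum K] = pmap h (enum K).
  have bst2 u : (bstate b u).2 = info u by rewrite IH.
  elim: (enum K) => //= k s ->; rewrite sim_recv ?IH //.
  by rewrite /h; case: pickP => [u _|_] //; rewrite IH.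
have -> : pmap (fun u => if adj v u then g u else None) (enum V)
          = pmap h (map col (filter (adj v) (enum V))).
  elim: (enum V) => //= u s ->; case: (boolP (adj v u)) => //= vu.
  have -> // : h (col u) = g u.
  rewrite /h; case: pickP => [u' /andP[vu' /eqP cu']|/(_ u)].
    by rewrite (@col_inj v u' u).
  by rewrite /= vu eqxx.
have -> : pmap h (enum K) =
    pmap h [seq k <- enum K | [exists u, adj v u && (col u == k)]].
  elim: (enum K) => //= k s ->; case: existsP => //= no_u.
  have -> // : h k = None.
  by rewrite /h; case: pickP => // u vu; case: no_u; exists u.
apply: perm_pmap; apply: uniq_perm.
- by rewrite filter_uniq // enum_uniq.
- rewrite map_inj_in_uniq; first exact/filter_uniq/enum_uniq.
  move=> u w.
  by rewrite !mem_filter => /andP[vu _] /andP[vw _]; apply: (@col_inj v).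
move=> k; rewrite mem_filter mem_enum andbT.
apply/existsP/mapP => [[u /andP[vu /eqP <-]]|[u]].
  by exists u => //; rewrite mem_filter vu mem_enum.
by rewrite mem_filter => /andP[vu _] ->; exists u; rewrite vu eqxx.
Qed.

Lemma sim_output v :
  nocd_output (B := sim_alg) adj (fun v => (inp v, info v)) rnd v
  = local_state adj A inp T v.
Proof. by rewrite nocd_output_block // sim_block_state. Qed.

Lemma sim_energy d : (forall v, #|lis v| <= d) ->
  nocd_energy (B := sim_alg) adj (fun v => (inp v, info v)) rnd
  <= local_energy adj A inp T * d.+1.
Proof.
move=> le_d; apply/bigmax_leqP => v _.
pose p b c := n_active (sim_act b c (local_state adj A inp b v, info v)).
pose q b := l_active (l_act A b (local_state adj A inp b v)).
rewrite (@eq_count _ _ (fun t => p (t %/ #|K|) (t %% #|K|))); last first.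
  by move=> t; rewrite nocd_is_active_block // sim_block_state.
apply: leq_trans (leq_mul (leq_bigmax v) (leqnn _)).
rewrite [b_len _]/=; apply: (count_block (q := q)) => // b _.
rewrite iota_enum_rank count_map.
have [qb|] := boolP (q b); last first.
  rewrite negb_or /p /sim_act /= mul0n => /andP[/negPf a1 /negPf a2].
  rewrite leqn0 -(count_pred0 (enum K)); apply/eqP/eq_count => k /=.
  rewrite a2; case: ifP => //; by case: (l_act _ _ _).1 a1.
rewrite mul1n; apply: leq_trans (_ : #|col v |: lis v| <= _); last first.
  by rewrite cardsU1 -add1n; apply: leq_add (leq_b1 _) (le_d v).
rewrite [X in _ <= X]cardE -size_filter.
apply: uniq_leq_size; first exact/filter_uniq/enum_uniq.
move=> k.
rewrite mem_filter mem_enum /p /sim_act /= => /andP[+ _].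
have rank_eq (k' : K) : (enum_rank k == enum_rank k' :> nat) = (k == k').
  by rewrite (inj_eq val_inj) (inj_eq enum_rank_inj).
rewrite rank_eq; rewrite !inE; case: eqP => //= _.
case: (_.2) => //=; case: existsP => // - [k' /andP[k'v +]] _.
by rewrite rank_eq => /eqP ->.
Qed.
End Sim.

(** * Distributed distance-2 colouring *)

Section Colouring.
Variables a b L W : nat.

(* Random bits of a vertex: [a] bits per slot, which must all be set for the *)
(* vertex to transmit in that slot, and [b] bits for each candidate colour.  *)
Definition bit_index := ('I_(4 * L * W).+1 * 'I_a + 'I_L.+1 * 'I_b)%type.
Definition nbits := #|{: bit_index}|.
Definition bits := {ffun 'I_nbits -> bool}.
Definition colour := {ffun 'I_b -> bool}.

(** [inord] is faithful for [t <= 4 * L * W], which covers the whole run. *)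
Definition transmits (x : bits) (t : nat) : bool :=
  [forall i : 'I_a, x (enum_rank (inl (inord t, i) : bit_index))].
Definition candidate (x : bits) (i : nat) : colour :=
  [ffun j => x (enum_rank (inr (inord i, j) : bit_index))].

(* Random strings serve as identifiers.  [ack_tab] lists the identifiers and *)
(* colours heard in the current trial, own ones included.                    *)
Record cstate := CState {
  ident : bits;
  nbrs : seq bits;
  fixed : option colour;
  ack_tab : seq (bits * colour);
  heard_cols : {set colour}
}.

Definition trial_colour (q : nat) (s : cstate) : colour :=
  odflt (candidate (ident s) (q - L)./2) (fixed s).

(** The table holds the own entry of [m], so an acknowledgement excludes a conflict with [m] itself
    as well as with the other neighbours of [m]. Completeness is required because an unheard
    neighbour could hide a conflict. *)
Definition acks (m : cstate) (x : bits) (k : colour) : bool :=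
  all (mem (map fst (ack_tab m))) (nbrs m) &&
  all (fun p => (p.2 == k) ==> (p.1 == x)) (ack_tab m).

Definition cstep (q : nat) (s : cstate) (ms : seq cstate) : cstate :=
  if q < L then
    CState (ident s) (map ident ms ++ nbrs s) (fixed s) (ack_tab s)
      (heard_cols s)
  else if q < 3 * L then
    if ~~ odd (q - L) then
      CState (ident s) (nbrs s) (fixed s)
        ((ident s, trial_colour q s)
           :: [seq (ident m, trial_colour q m) | m <- ms])
        (heard_cols s)
    else if all (fun x => has (fun m => (ident m == x) &&
                    acks m (ident s) (trial_colour q s)) ms) (nbrs s) then
      CState (ident s) (nbrs s) (Some (trial_colour q s)) (ack_tab s)
        (heard_cols s)
    else s
  else CState (ident s) (nbrs s) (fixed s) (ack_tab s)
         (heard_cols s :|: [set k in [seq trial_colour q m | m <- ms]]).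

Definition cupd (q : nat) (s : cstate) (l : seq (option cstate)) : cstate :=
  cstep q s (pmap id l).
Definition cinit (_ : unit) (x : bits) := CState x [::] None [::] set0.
(** A message is the entire state of its sender; message size is not restricted in the model. *)
Definition cact (q j : nat) (s : cstate) : nocd_action cstate :=
  if transmits (ident s) (q * W + j) then NTransmit s else NListen.
Definition cout (s : cstate) := (odflt [ffun=> false] (fixed s), heard_cols s).

(* Rounds of [W] slots in which every vertex transmits its state at random:  *)
(* [L] rounds to learn the neighbours' identifiers, [L] trials of two rounds *)
(* (announce the trial colour, then acknowledge the absence of conflict),    *)
(* and [L] rounds to learn the neighbours' final colours.                    *)
Definition colouring_alg : nocd_alg unit (colour * {set colour}) :=
  block_alg W (4 * L) cinit cact cupd cout.

(** * The run as a function of the transmission pattern *)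

Section Run.
Variables (V : finType) (adj : rel V).
Implicit Types (rnd : {ffun V -> bits}) (u v w : V).

Definition hears rnd (t : nat) v : option V :=
  if transmits (rnd v) t then None
  else if [seq u <- enum V | adj v u && transmits (rnd u) t] is [:: u]
       then Some u else None.

Definition heard rnd (q : nat) v : seq V :=
  pmap (fun j => hears rnd (q * W + j) v) (iota 0 W).

Lemma hears_adj rnd t v u : hears rnd t v = Some u -> adj v u.
Proof.
rewrite /hears; case: ifP => // _.
case E : (filter _ _) => [|u' [|]] // [<-].
have : u' \in [:: u'] by rewrite inE.
by rewrite -E mem_filter => /andP[/andP[]].
Qed.

Lemma heard_adj rnd q v u : u \in heard rnd q v -> adj v u.
Proof.
rewrite /heard; elim: (iota 0 W) => //= j s IH.
case E : (hears _ _ _) => [w|] //=; rewrite inE => /orP[/eqP ->|//].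
exact: hears_adj E.
Qed.

Definition abs_colour rnd i (f : V -> option colour) v : colour :=
  odflt (candidate (rnd v) i) (f v).

(** The fixing rule of [cstep], with vertices in place of identifiers. *)
Definition trial_ok rnd i (f : V -> option colour) v : bool :=
  [forall (u | adj v u),
     [&& u \in heard rnd (L + i.*2).+1 v,
         [forall (w | adj u w), (w == u) || (w \in heard rnd (L + i.*2) u)] &
         [forall (w | (w == u) || (w \in heard rnd (L + i.*2) u)),
            (abs_colour rnd i f w == abs_colour rnd i f v) ==> (w == v)]]].

(* The colours fixed by the first [i] trials, when identifiers are distinct *)
(* and every vertex knows those of its neighbours.                          *)
Fixpoint abs_fixed rnd (i : nat) : V -> option colour :=
  if i is i'.+1 then fun v =>
    let f := abs_fixed rnd i' in
    if trial_ok rnd i' f v then Some (abs_colour rnd i' f v) else f v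
  else fun=> None.

(** If [u] passes a trial, no other vertex within distance 2 displays its colour: a neighbour checks
    its own entry, and a common neighbour has heard everybody around it. A fixed colour is displayed
    in all later trials, so it suffices to apply this to whichever of the two vertices passes trial
    [i]. *)
Lemma abs_fixed_inj rnd i u v k : symmetric adj ->
  adj u v \/ (exists2 w, adj u w & adj w v) ->
  abs_fixed rnd i u = Some k -> abs_fixed rnd i v = Some k -> u = v.
Proof.
move=> adj_sym.
have ok_inj i' f u' v' : adj u' v' \/ (exists2 w, adj u' w & adj w v') ->
    trial_ok rnd i' f u' -> abs_colour rnd i' f v' = abs_colour rnd i' f u' ->
    v' = u'.
  move=> near /forall_inP ok /eqP eq_col; apply/eqP.
  case: near => [uv|[w uw wv]].
    have /and3P[_ _ /forall_inP/(_ v')] := ok _ uv.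
    by rewrite eqxx eq_col; apply.
  have /and3P[_ /forall_inP/(_ v' wv) hv /forall_inP/(_ v' hv)] := ok _ uw.
  by rewrite eq_col; apply.
elim: i u v => //= i IH u v near.
have near' : adj v u \/ (exists2 w, adj v w & adj w u).
  case: near => [uv|[w uw wv]]; first by left; rewrite adj_sym.
  by right; exists w; rewrite adj_sym.
have colE w : abs_fixed rnd i w = Some k ->
    abs_colour rnd i (abs_fixed rnd i) w = k by rewrite /abs_colour => ->.
case: ifP => oku; case: ifP => okv.
- by move=> [ku] [kv]; apply: esym (ok_inj _ _ _ _ near oku _); rewrite ku kv.
- by move=> [ku] /colE kv; apply: esym (ok_inj _ _ _ _ near oku _); rewrite ku kv.
- by move=> /colE ku [kv]; apply: (ok_inj _ _ _ _ near' okv); rewrite ku kv.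
exact: IH.
Qed.

Hypothesis W_gt0 : 0 < W.
Variable rnd : {ffun V -> bits}.

Local Notation st := (block_state W cinit cact cupd adj (fun=> tt) rnd).

Lemma ident_st q v : ident (st q v) = rnd v.
Proof.
elim: q v => // q IH v; rewrite block_stateS -[RHS]IH /cupd /cstep.
by do 4?case: ifP.
Qed.

Lemma recv_st q j v :
  nocd_recv adj (fun u => cact q j (st q u)) v
  = omap (st q) (hears rnd (q * W + j) v).
Proof.
rewrite /nocd_recv /hears /cact ident_st; case: ifP => // _.
rewrite (_ : pmap _ _ = map (st q)
  [seq u <- enum V | adj v u && transmits (rnd u) (q * W + j)]).
  by case: (filter _ _) => [|? []].
elim: (enum V) => //= u s ->; rewrite ident_st.
by case: (adj v u); case: (transmits _ _).
Qed.

Lemma st_S q v : st q.+1 v = cstep q (st q v) (map (st q) (heard rnd q v)).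
Proof.
rewrite block_stateS /cupd /heard; congr (cstep _ _ _).
elim: (iota 0 W) => //= j s ->; rewrite recv_st.
by case: (hears _ _ _).
Qed.

Lemma nbrs_stS q v : nbrs (st q.+1 v) =
  if q < L then map rnd (heard rnd q v) ++ nbrs (st q v) else nbrs (st q v).
Proof.
rewrite st_S /cstep; case: ifP => //= _; last by do 3?case: ifP.
by congr (_ ++ _); rewrite -map_comp; apply: eq_map => u /=; rewrite ident_st.
Qed.

Hypothesis rnd_inj : injective rnd.
Hypothesis learned : forall v u, adj v u ->
  exists2 q, q < L & u \in heard rnd q v.

Lemma mem_nbrs_le q v x : q <= L -> reflect
  (exists2 q', q' < q & exists2 u, u \in heard rnd q' v & x = rnd u)
  (x \in nbrs (st q v)).
Proof.
elim: q x => [x _|q IH x qL]; first by constructor => -[].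
rewrite nbrs_stS qL mem_cat; apply: (iffP orP).
  case=> [/mapP[u uv ->]|/(IH _ (ltnW qL))[q' lt_q']].
    by exists q => //; exists u.
  by exists q' => //; apply: ltnW.
case=> q'; rewrite ltnS leq_eqVlt => /orP[/eqP ->|lt_q'] [u uv ->].
  by left; apply: map_f.
right; by apply/(IH _ (ltnW qL)); exists q' => //; exists u.
Qed.

Lemma mem_nbrs q v u : L <= q -> (rnd u \in nbrs (st q v)) = adj v u.
Proof.
elim: q => [|q IH]; rewrite leq_eqVlt => /orP[/eqP eqL|].
- by apply/idP/idP => // /learned[q']; rewrite eqL.
- by [].
- rewrite -eqL; apply/mem_nbrs_le/idP => // [[q' _ [w + /rnd_inj ->]]|].
    exact: heard_adj.
  by case/learned => q' lt_q' uv; exists q' => //; exists u.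
by rewrite ltnS => le_q; rewrite nbrs_stS ltnNge le_q; apply: IH.
Qed.

Lemma nbrs_id q v x : x \in nbrs (st q v) -> exists u, x = rnd u.
Proof.
elim: q => // q IH; rewrite nbrs_stS; case: ifP => // _.
by rewrite mem_cat => /orP[/mapP[u _ ->]|//]; exists u.
Qed.

Lemma trial_halfK i : (L + i.*2 - L)./2 = i /\ ((L + i.*2).+1 - L)./2 = i.
Proof. by rewrite -addnS !addKn doubleK -[_.+1]add1n halfD /= doubleK odd_double. Qed.

(** Trial [i] occupies rounds [L + i.*2] and [(L + i.*2).+1]. Distinct identifiers turn tests on
    strings into tests on vertices, and [mem_nbrs] says that completeness is checked against the
    true neighbourhood. *)
Lemma fixed_trial i v : i <= L -> fixed (st (L + i.*2) v) = abs_fixed rnd i v.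
Proof.
elim: i v => [|i IH] v.
  (* No colour is fixed during the [L] learning rounds. *)
  rewrite addn0 => _; have : L <= L by [].
  move: {1 3}L => q; elim: q => // q IHq qL.
  by rewrite st_S /cstep qL IHq // ltnW.
move=> lt_iL; have {}IH u := IH u (ltnW lt_iL).
have le_q : L <= L + i.*2 by rewrite leq_addr.
have lt_q : (L + i.*2).+1 < 3 * L.
  by rewrite -!addnS -doubleS !mulSn mul0n addn0 leq_add2l addnn leq_double.
have [half0 half1] := trial_halfK i.
have colE u : trial_colour (L + i.*2) (st (L + i.*2) u)
              = abs_colour rnd i (abs_fixed rnd i) u.
  by rewrite /trial_colour IH half0 ident_st.
have stS u : st (L + i.*2).+1 u =
    CState (rnd u) (nbrs (st (L + i.*2) u)) (abs_fixed rnd i u)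
      [seq (rnd w, abs_colour rnd i (abs_fixed rnd i) w)
         | w <- u :: heard rnd (L + i.*2) u]
      (heard_cols (st (L + i.*2) u)).
  rewrite st_S /cstep ltnNge le_q /= ltnW // addKn odd_double /=.
  rewrite colE ident_st IH -map_comp; congr (CState _ _ _ (_ :: _) _).
  by apply: eq_map => w /=; rewrite ident_st colE.
have colSE u : trial_colour (L + i.*2).+1 (st (L + i.*2).+1 u)
              = abs_colour rnd i (abs_fixed rnd i) u.
  by rewrite stS /trial_colour /= half1.
rewrite doubleS !addnS.
have -> : fixed (st (L + i.*2).+2 v) =
  if all (fun x => has (fun m => (ident m == x) &&
       acks m (rnd v) (abs_colour rnd i (abs_fixed rnd i) v))
            (map (st (L + i.*2).+1) (heard rnd (L + i.*2).+1 v)))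
         (nbrs (st (L + i.*2).+1 v))
  then Some (abs_colour rnd i (abs_fixed rnd i) v) else abs_fixed rnd i v.
  rewrite st_S /cstep ltnNge leqW // lt_q -[X in odd (X - _)]addnS addKn.
  rewrite -[odd _]/(~~ odd i.*2) odd_double colSE ident_st.
  by case: ifP => //; rewrite stS.
rewrite [RHS]/=; congr (if _ then _ else _).
have acksE u : acks (st (L + i.*2).+1 u) (rnd v)
    (abs_colour rnd i (abs_fixed rnd i) v) =
  [forall (w | adj u w), (w == u) || (w \in heard rnd (L + i.*2) u)] &&
  [forall (w | (w == u) || (w \in heard rnd (L + i.*2) u)),
     (abs_colour rnd i (abs_fixed rnd i) w
        == abs_colour rnd i (abs_fixed rnd i) v) ==> (w == v)].
  have tabE : ack_tab (st (L + i.*2).+1 u) =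
      [seq (rnd w, abs_colour rnd i (abs_fixed rnd i) w)
         | w <- u :: heard rnd (L + i.*2) u] by rewrite stS.
  have identE : map fst (ack_tab (st (L + i.*2).+1 u)) =
      map rnd (u :: heard rnd (L + i.*2) u) by rewrite tabE -map_comp.
  rewrite /acks identE tabE; congr (_ && _).
    apply/allP/forall_inP => [H w uw|H x].
      have := H (rnd w); rewrite mem_nbrs ?leqW // => /(_ uw).
      by rewrite /= -map_cons (mem_map rnd_inj) inE.
    move=> xu; have [w xw] := nbrs_id xu; move: xu; rewrite xw mem_nbrs ?leqW //.
    by move/H; rewrite /= -map_cons (mem_map rnd_inj) inE.
  apply/allP/forall_inP => H x.
    move=> xu; have := H (rnd x, abs_colour rnd i (abs_fixed rnd i) x).
    rewrite /= (inj_eq rnd_inj); apply.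
    by apply: (map_f (fun w => (rnd w, abs_colour rnd i (abs_fixed rnd i) w))
                     (s := u :: heard rnd (L + i.*2) u)); rewrite inE.
  case/mapP=> w; rewrite inE => /H + ->.
  by rewrite /= (inj_eq rnd_inj).
rewrite /trial_ok; apply/allP/forall_inP => [H u vu|H x].
  have := H (rnd u); rewrite mem_nbrs ?leqW // => /(_ vu).
  rewrite has_map => /hasP[u' hu' /=]; rewrite ident_st (inj_eq rnd_inj).
  case/andP=> /eqP eq_u; rewrite eq_u acksE in hu' * => /andP[h1 h2].
  by rewrite hu' h1.
move=> xv; have [u xu] := nbrs_id xv; move: xv; rewrite xu mem_nbrs ?leqW //.
move/H => /and3P[hu h1 h2]; rewrite has_map; apply/hasP.
by exists u => //=; rewrite ident_st eqxx acksE h1 h2.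
Qed.

Hypothesis all_fixed : forall v, isSome (abs_fixed rnd L v).
Hypothesis learned_cols : forall v u, adj v u ->
  exists2 q, 3 * L <= q < 4 * L & u \in heard rnd q v.

Definition final_colour v : colour := odflt [ffun=> false] (abs_fixed rnd L v).

Lemma fixed_final d v : fixed (st (3 * L + d) v) = abs_fixed rnd L v.
Proof.
elim: d => [|d IH]; last first.
  rewrite addnS st_S /cstep !ltnNge leq_addr /= IH.
  by rewrite (leq_trans _ (leq_addr _ _)) // leq_pmull.
by rewrite addn0 -fixed_trial // -addnn !mulSn mul0n addn0.
Qed.

Lemma heard_cols_le q v : q <= 3 * L -> heard_cols (st q v) = set0.
Proof.
elim: q => // q IH lt_q; rewrite -[RHS](IH (ltnW lt_q)) st_S /cstep lt_q.
by do 3?case: ifP.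
Qed.

Lemma heard_cols_final d v k :
  k \in heard_cols (st (3 * L + d) v) <->
  exists2 q, 3 * L <= q < 3 * L + d &
    exists2 u, u \in heard rnd q v & k = final_colour u.
Proof.
elim: d k => [|d IH] k.
  rewrite addn0 heard_cols_le // inE; split=> // -[q].
  by rewrite leqNgt; case: (q < 3 * L).
have colE u : trial_colour (3 * L + d) (st (3 * L + d) u) = final_colour u.
  rewrite /trial_colour fixed_final /final_colour.
  by case: (abs_fixed _ _ _) (all_fixed u).
rewrite addnS st_S /cstep !ltnNge leq_addr /=.
rewrite (leq_trans _ (leq_addr _ _)) ?leq_pmull //= in_setU.
rewrite inE -map_comp (eq_map colE); split.
  case/orP=> [/IH[q /andP[le_q lt_q] hk]|/mapP[u hu ->]].
    by exists q; rewrite // le_q leqW.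
  by exists (3 * L + d); [rewrite leq_addr /=|exists u].
case=> q /andP[le_q]; rewrite ltnS leq_eqVlt => /orP[/eqP eq_q|lt_q] [u hu ->].
  by rewrite -eq_q map_f ?orbT.
by apply/orP; left; apply/IH; exists q; [rewrite le_q|exists u].
Qed.

Lemma colouring_output v :
  nocd_output (B := colouring_alg) adj (fun=> tt) rnd v
  = (final_colour v, [set final_colour u | u in adj v]).
Proof.
rewrite nocd_output_block // -[4]/(3 + 1) mulnDl mul1n /cout fixed_final.
congr (_, _); apply/setP=> k; apply/idP/imsetP.
  case/heard_cols_final=> q _ [u hu ->]; exists u => //.
  exact: heard_adj hu.
case=> u vu ->; apply/heard_cols_final.
have [q q_int hu] := learned_cols vu.
by exists q; [rewrite -[L in _ + L]mul1n -mulnDl|exists u].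
Qed.

Lemma final_colour_inj u v : symmetric adj ->
  adj u v \/ (exists2 w, adj u w & adj w v) ->
  final_colour u = final_colour v -> u = v.
Proof.
move=> adj_sym near eq_col.
have colE w : abs_fixed rnd L w = Some (final_colour w).
  by rewrite /final_colour; case: (abs_fixed _ _ _) (all_fixed w).
by apply: (abs_fixed_inj adj_sym near (colE u)); rewrite eq_col.
Qed.

End Run.
End Colouring.

(** * Success probability of the colouring *)

Section Success.
Variables a b L W : nat.
Variables (V : finType) (adj : rel V).
Local Notation R := (nbits a b L W).
Local Notation index := (bit_index a b L W).
Local Notation Omega := {ffun V -> {ffun 'I_R -> bool}}.
Local Notation transmits := (@transmits a b L W).
Local Notation candidate := (@candidate a b L W).
Local Notation hears := (@hears a b L W V adj).
Local Notation heard := (@heard a b L W V adj).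
Local Notation abs_colour := (@abs_colour a b L W V).
Local Notation trial_ok := (@trial_ok a b L W V adj).
Local Notation abs_fixed := (@abs_fixed a b L W V adj).
Implicit Types (x y r : Omega) (u v w : V).

Definition on_bits (P : pred index) (v : V) (i : 'I_R) := P (enum_val i).

(** The boolean [c] tells whether the bits of slot [t] are among the redrawn ones. *)
Lemma transmits_resample (P : pred index) c x y v t :
  (forall i, P (inl (inord t, i)) = c) ->
  transmits (resample (on_bits P) x y v) t
  = if c then transmits (y v) t else transmits (x v) t.
Proof.
move=> Pc; rewrite /transmits; case: c Pc => Pc; apply: eq_forallb => i;
  by rewrite resampleE /on_bits enum_rankK Pc.
Qed.

Lemma candidate_resample (P : pred index) c x y v i :
  (forall j, P (inr (inord i, j)) = c) ->
  candidate (resample (on_bits P) x y v) i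
  = if c then candidate (y v) i else candidate (x v) i.
Proof.
move=> Pc; apply/ffunP=> j; rewrite ffunE resampleE /on_bits enum_rankK Pc.
by case: c {Pc}; rewrite ffunE.
Qed.

Lemma eq_hears x x' t v :
  (forall u, transmits (x u) t = transmits (x' u) t) ->
  hears x t v = hears x' t v.
Proof.
move=> eq_tx; rewrite /hears eq_tx.
rewrite (@eq_filter _ _ (fun u => adj v u && transmits (x' u) t)) // => u.
by rewrite eq_tx.
Qed.

Lemma eq_heard x x' q v :
  (forall u t, q * W <= t < q.+1 * W -> transmits (x u) t = transmits (x' u) t) ->
  heard x q v = heard x' q v.
Proof.
move=> eq_tx; apply: eq_in_pmap => j; rewrite mem_iota add0n => /andP[_ jW].
by apply: eq_hears => u; apply: eq_tx; rewrite leq_addr mulSnr ltn_add2l.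
Qed.

Lemma card_transmits (U : {set V}) t :
  #|[set y : Omega | [forall (u | u \in U), transmits (y u) t]]|
    * 2 ^ (#|U| * a) = #|{: Omega}|.
Proof.
pose f (i : 'I_a) : 'I_R := enum_rank (inl (inord t, i) : index).
have f_inj : injective f by move=> i j /enum_rank_inj [].
rewrite -(card_bits U (fun _ _ => true) f_inj); congr (_ * _).
apply: eq_card => y; rewrite !inE; apply: eq_forallb => u; congr (_ ==> _).
by apply: eq_forallb => i; rewrite eqb_id.
Qed.

Lemma card_candidate v i k :
  #|[set y : Omega | candidate (y v) i == k]| * 2 ^ b = #|{: Omega}|.
Proof.
pose f (j : 'I_b) : 'I_R := enum_rank (inr (inord i, j) : index).
have f_inj : injective f by move=> j j' /enum_rank_inj [].
rewrite -(card_bits [set v] (fun _ j => k j) f_inj) cards1 mul1n.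
congr (_ * _); apply: eq_card => y; rewrite !inE; apply/eqP/forall_inP.
  by move=> <- u; rewrite inE => /eqP ->; apply/forallP=> j; rewrite ffunE.
move/(_ v); rewrite inE eqxx => /(_ isT)/forallP eq_k; apply/ffunP=> j.
by rewrite ffunE; apply/eqP/eq_k.
Qed.

(** * Probability of hearing a neighbour *)

Variable Delta : nat.
Hypothesis adj_sym : symmetric adj.
Hypothesis adj_irr : irreflexive adj.
Hypothesis degree_le : forall v, #|[set u | adj v u]| <= Delta.
Hypothesis a_large : 2 * Delta <= 2 ^ a.

(* Bonferroni: [u] alone transmits with probability at least                 *)
(* 2^-a - Delta 2^-2a, and 2^-2a is the pairwise collision probability.      *)
Lemma card_hears t v u : adj v u ->
  #|{: Omega}| <= #|[set y : Omega | hears y t v == Some u]| * 2 ^ a.+1.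
Proof.
move=> vu; set good := [set y | _]; set X := #|{: Omega}|.
pose tx (U : {set V}) :=
  [set y : Omega | [forall (w | w \in U), transmits (y w) t]].
(* By half duplex [v] itself is a disturber; it takes the place of [u], so the count stays at most
   [Delta]. *)
pose others := (v |: [set w | adj v w]) :\ u.
have card_others : #|others| <= Delta.
  have := cardsD1 u (v |: [set w | adj v w]).
  rewrite cardsU1 !inE adj_irr vu orbT /= => /eqP.
  by rewrite eqn_add2l => /eqP <-.
have sub : tx [set u] \subset good :|:
    [set y | [exists (w | w \in others), y \in tx [set u; w]]].
  apply/subsetP=> y; rewrite inE => /forall_inP tx_y.
  have tx_u : transmits (y u) t by apply: tx_y; rewrite inE.
  rewrite in_setU [X in _ || X]inE; apply/orP.
  have [|not_tx] := boolP [exists (w | w \in others), y \in tx [set u; w]].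
    by right.
  left; rewrite inE.
  have no_tx w : w \in others -> transmits (y w) t = false.
    move=> ow; apply: contraNF not_tx => tx_w; apply/exists_inP; exists w => //.
    by rewrite inE; apply/forall_inP=> z; rewrite !inE => /orP[] /eqP ->.
  rewrite /hears no_tx ?inE ?eqxx; last first.
    by rewrite andbT; apply: contraTneq vu => ->; rewrite adj_irr.
  have -> : [seq w <- enum V | adj v w & transmits (y w) t] = [:: u] => //.
  rewrite -(filter_pred1_uniq (enum_uniq V) (mem_enum _ u)).
  apply: eq_filter => w /=; have [->|neq] := eqVneq w u; first by rewrite vu.
  by apply/negP=> /andP[vw]; rewrite no_tx // !inE neq vw orbT.
have card_u : #|tx [set u]| * 2 ^ a = X.
  by rewrite /X -(card_transmits [set u] t) cards1 mul1n.
have card_uw w : w \in others -> #|tx [set u; w]| * 2 ^ (2 * a) = X.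
  rewrite !inE => /andP[neq _].
  by rewrite /X -(card_transmits [set u; w] t) cards2 eq_sym neq.
have le_sum : #|tx [set u]| * 2 ^ (2 * a)
              <= #|good| * 2 ^ (2 * a) + Delta * X.
  apply: leq_trans (leq_mul (subset_leq_card sub) (leqnn _)) _.
  apply: leq_trans (leq_mul (leq_card_setU _ _) (leqnn _)) _.
  rewrite mulnDl leq_add2l.
  apply: leq_trans (leq_mul card_others (leqnn X)).
  apply: (@card_exists _ _ _ (mem others)) => w ow.
  rewrite -(card_uw _ ow) leq_mul2r; apply/orP; right.
  by apply/subset_leq_card/subsetP=> y; rewrite inE.
have {}le_sum : 2 ^ a * X <= #|good| * 2 ^ (2 * a) + Delta * X.
  by apply: leq_trans le_sum; rewrite mul2n -addnn expnD mulnA card_u mulnC.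
have a_gt0 : 0 < 2 ^ a by rewrite expn_gt0.
rewrite expnS; rewrite mul2n -addnn expnD in le_sum.
(* By [a_large] the loss [Delta * X] is at most half of the main term [2 ^ a * X]. *)
nia.
Qed.
Local Notation H := (2 ^ a.+1).

Lemma hears_resample (P : pred index) c x y t v :
  (forall i, P (inl (inord t, i)) = c) ->
  hears (resample (on_bits P) x y) t v = if c then hears y t v else hears x t v.
Proof.
move=> Pc; case: c Pc => Pc; apply: eq_hears => u;
  by rewrite (transmits_resample _ _ _ Pc).
Qed.

(** Distinct slots use disjoint bits, so each slot is a stage missed with probability at most 1 -
    1/H; by [pow_pred_half], every group of H slots contributes a factor 1/2. *)
Lemma card_deaf (s m : nat) v u : adj v u -> s + H * m <= 4 * L * W ->
  #|[set y : Omega | [forall j : 'I_(H * m), hears y (s + j) v != Some u]]|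
    * 2 ^ m <= #|{: Omega}|.
Proof.
move=> vu le_s; set X := #|_|.
pose P t (p : index) := if p is inl (s', _) then s' == t :> nat else false.
have P_inord t t' i : t' <= 4 * L * W -> P t (inl (inord t', i)) = (t' == t).
  by move=> le_t; rewrite /P inordK.
have H_gt0 : 0 < H.-1 by rewrite -ltnS prednK ?expn_gt0 // -{1}(expn0 2) ltn_exp2l.
have le_X : X * H ^ (H * m) <= H.-1 ^ (H * m) * #|{: Omega}|.
  apply: (card_stages (D := fun j => on_bits (P (s + j)))
            (bad := fun j (y : Omega) => hears y (s + j) v != Some u)).
    move=> i j x y /andP[ij jm]; rewrite (@hears_resample _ false) // => k.
    rewrite P_inord ?eqn_add2l ?(ltn_eqF ij) //.
    by apply: leq_trans le_s; rewrite leq_add2l ltnW // (ltn_trans ij).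
  move=> i x im; have le_i : s + i <= 4 * L * W.
    by apply: leq_trans le_s; rewrite leq_add2l ltnW.
  rewrite (_ : [set y | _] = [set y : Omega | hears y (s + i) v != Some u]).
    2: by apply/setP=> y; rewrite !inE (@hears_resample _ true) // => k;
       rewrite P_inord ?eqxx.
  have := card_hears (s + i) vu.
  have := cardsC [set y : Omega | hears y (s + i) v == Some u].
  rewrite -[X in _ = X]/#|{: Omega}|.
  rewrite (_ : ~: _ = [set y : Omega | hears y (s + i) v != Some u]); last first.
    by apply/setP=> y; rewrite !inE.
  move: H_gt0; generalize (2 ^ a.+1) => h; case: h => // h _; rewrite [h.+1.-1]/=.
  generalize #|[set y : Omega | hears y (s + i) v == Some u]|.
  generalize #|[set y : Omega | hears y (s + i) v != Some u]|.
  generalize #|{: Omega}| => X' n1 n2 <-; clear; nia.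
have le_half : 2 ^ m * H.-1 ^ (H * m) <= H ^ (H * m).
  have [->|m_gt0] := posnP m; first by rewrite muln0 !expn0.
  rewrite !expnM -expnMn leq_exp2r //.
  by have := pow_pred_half H_gt0; rewrite prednK // expn_gt0.
have pow_gt0 : 0 < H.-1 ^ (H * m) by rewrite expn_gt0 H_gt0.
rewrite -(leq_pmul2l pow_gt0); apply: leq_trans le_X.
by rewrite mulnCA leq_mul2l mulnC le_half orbT.
Qed.

Hypothesis W_def : W = H * b.
Hypothesis b_gt0 : 0 < b.

Lemma card_not_heard q v u : adj v u -> q < 4 * L ->
  #|[set y : Omega | u \notin heard y q v]| * 2 ^ b <= #|{: Omega}|.
Proof.
move=> vu lt_q; apply: leq_trans (card_deaf (s := q * W) (m := b) vu _).
  rewrite leq_mul2r; apply/orP; right; apply/subset_leq_card/subsetP=> y.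
  rewrite !inE => not_heard; apply/forallP=> j; apply: contraNneq not_heard => h.
  rewrite mem_pmap; apply/mapP; exists (val j) => //.
  by rewrite mem_iota W_def /=.
by rewrite -W_def -mulSnr leq_mul2r lt_q orbT.
Qed.

Lemma card_never_heard q0 v u : adj v u -> q0 + L <= 4 * L ->
  #|[set y : Omega | [forall i : 'I_L, u \notin heard y (q0 + i) v]]| * 2 ^ L
  <= #|{: Omega}|.
Proof.
move=> vu le_q; apply: leq_trans (card_deaf (s := q0 * W) (m := b * L) vu _).
  apply: leq_mul; last by rewrite leq_exp2l // leq_pmull.
  apply/subset_leq_card/subsetP=> y.
  rewrite !inE => /forallP not_heard; apply/forallP=> j.
  have W_gt0 : 0 < W by rewrite W_def muln_gt0 expn_gt0.
  have eqLW : L * W = H * (b * L) by rewrite mulnC W_def -mulnA.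
  have lt_j : j %/ W < L by rewrite ltn_divLR // eqLW.
  apply: contraNneq (not_heard (Ordinal lt_j)) => h.
  rewrite mem_pmap; apply/mapP; exists (j %% W); first by rewrite mem_iota ltn_pmod.
  by rewrite /= mulnDl -addnA -divn_eq.
by rewrite mulnA -W_def (mulnC W) -mulnDl leq_mul2r le_q orbT.
Qed.

(** * Success of one trial and of all trials *)

Lemma eq_trial_ok x x' i f f' v : f =1 f' ->
  (forall u t, (L + i.*2) * W <= t < (L + i.*2).+2 * W ->
     transmits (x u) t = transmits (x' u) t) ->
  (forall u, candidate (x u) i = candidate (x' u) i) ->
  trial_ok x i f v = trial_ok x' i f' v /\
  abs_colour x i f v = abs_colour x' i f' v.
Proof.
move=> eq_f eq_tx eq_cand.
have eq_col w : abs_colour x i f w = abs_colour x' i f' w.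
  by rewrite /abs_colour eq_f eq_cand.
have eq_h0 w : heard x (L + i.*2) w = heard x' (L + i.*2) w.
  apply: eq_heard => u t /andP[le_t lt_t]; apply: eq_tx; rewrite le_t.
  by apply: leq_trans lt_t _; rewrite leq_mul2r leqnSn orbT.
have eq_h1 w : heard x (L + i.*2).+1 w = heard x' (L + i.*2).+1 w.
  apply: eq_heard => u t /andP[le_t lt_t]; apply: eq_tx; rewrite lt_t andbT.
  by apply: leq_trans le_t; rewrite leq_mul2r leqnSn orbT.
split=> //; apply: eq_forallb => u; rewrite eq_h1; congr (_ ==> [&& _, _ & _]).
  by apply: eq_forallb => w; rewrite eq_h0.
by apply: eq_forallb => w; rewrite eq_h0 !eq_col.
Qed.

Lemma eq_abs_fixed x x' i v :
  (forall u t, t < (L + i.*2) * W -> transmits (x u) t = transmits (x' u) t) ->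
  (forall u j, j < i -> candidate (x u) j = candidate (x' u) j) ->
  abs_fixed x i v = abs_fixed x' i v.
Proof.
elim: i v => // i IH v eq_tx eq_cand.
have {}IH u : abs_fixed x i u = abs_fixed x' i u.
  apply: IH => [w t lt_t|w j ji]; last by apply: eq_cand; apply: ltnW.
  apply: eq_tx; apply: leq_trans lt_t _.
  by rewrite leq_mul2r leq_add2l leq_double leqnSn orbT.
have [|u|eq_ok eq_col] := @eq_trial_ok x x' i _ _ v IH.
- by move=> u t /andP[_ lt_t]; apply: eq_tx; rewrite doubleS !addnS.
- exact: eq_cand.
by rewrite /= eq_ok eq_col IH.
Qed.

(** As [v] is unfixed its colour is fresh, and redrawing only the bits of [v] leaves the colour of
    [w] in place. *)
Lemma card_clash i f v w : w != v -> f v = None ->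
  #|[set y : Omega | abs_colour y i f w == abs_colour y i f v]| * 2 ^ b
  <= #|{: Omega}|.
Proof.
move=> neq fv; rewrite -[X in _ <= X]mul1n.
apply: (card_resample1 (D := fun u _ => u == v)) => x; rewrite mul1n.
rewrite -(card_candidate v i (abs_colour x i f w)) leq_mul2r; apply/orP; right.
apply/subset_leq_card/subsetP=> y; rewrite !inE /abs_colour fv /=.
have -> : candidate (resample (fun u _ => u == v) x y w) i = candidate (x w) i.
  by apply/ffunP=> j; rewrite !ffunE (negPf neq).
have -> // : candidate (resample (fun u _ => u == v) x y v) i = candidate (y v) i.
  by apply/ffunP=> j; rewrite !ffunE eqxx.
by rewrite eq_sym.
Qed.

Hypothesis Delta_gt0 : 0 < Delta.
Hypothesis b_large : 8 * Delta ^ 2 <= 2 ^ b.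

(** For each of at most Delta neighbours [u] there are 1 + Delta + (Delta + 1) bad events of
    probability at most 2^-b: [v] misses [u], [u] misses a neighbour, or a vertex near [u] clashes
    with [v]. This makes at most 4 Delta^2 events, against 2^b >= 8 Delta^2. As [f] is arbitrary,
    the bound survives conditioning on earlier trials. *)
Lemma card_trial_fails i f v : i < L -> f v = None ->
  #|[set y : Omega | ~~ trial_ok y i f v]| * 2 <= #|{: Omega}|.
Proof.
move=> iL fv; set X := #|{: Omega}|; pose q := L + i.*2.
have lt_q : q.+1 < 4 * L.
  have : i.*2.+2 <= L.*2 by rewrite -doubleS leq_double.
  by rewrite /q; lia.
pose near u : pred V := [pred w | ((w == u) || adj u w) && (w != v)].
have card_near u : #|near u| <= Delta.+1.
  apply: leq_trans (_ : #|u |: [set w | adj u w]| <= _).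
    by apply/subset_leq_card/subsetP=> w; rewrite !inE => /andP[].
  by rewrite cardsU1 -[Delta.+1]add1n; apply: leq_add (leq_b1 _) (degree_le u).
have card_adj u : #|adj u| <= Delta.
  by apply: leq_trans (degree_le u); rewrite cardsE.
pose fails u (y : Omega) := [|| u \notin heard y q.+1 v,
  [exists (w | adj u w), w \notin heard y q u] |
  [exists (w | near u w), abs_colour y i f w == abs_colour y i f v]].
have card_fails u : adj v u ->
    #|[set y | fails u y]| * 2 ^ b <= X + (Delta * X + Delta.+1 * X).
  move=> vu; apply: card_or; first exact: card_not_heard.
  apply: card_or.
    apply: leq_trans (leq_mul (card_adj u) (leqnn X)).
    by apply: card_exists => w uw; apply: card_not_heard => //; apply: ltnW.
  apply: leq_trans (leq_mul (card_near u) (leqnn X)).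
  by apply: card_exists => w /andP[_ neq]; apply: card_clash.
have card_ex := card_exists card_fails.
have sub : #|[set y : Omega | ~~ trial_ok y i f v]| * 2 ^ b
   <= Delta * (X + (Delta * X + Delta.+1 * X)).
  apply: leq_trans (leq_mul (card_adj v) (leqnn _)).
  apply: card_subpred card_ex => y.
  rewrite negb_forall_in => /exists_inP[u vu]; rewrite !negb_and => fail_u.
  apply/exists_inP; exists u => //; rewrite /fails.
  case/or3P: fail_u => [->//||].
    rewrite negb_forall_in => /exists_inP[w uw]; rewrite negb_or => /andP[_ hw].
    by apply/or3P/Or32/exists_inP; exists w.
  rewrite negb_forall_in => /exists_inP[w hw]; rewrite negb_imply => /andP[cw neq].
  apply/or3P/Or33/exists_inP; exists w; rewrite // /near /= neq andbT.
  by case/orP: hw => [->//|/heard_adj ->]; rewrite orbT.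
have b2_gt0 : 0 < 2 ^ b by rewrite expn_gt0.
move: sub b_large Delta_gt0; move: (2 ^ b) b2_gt0 => B.
generalize #|[set y : Omega | ~~ trial_ok y i f v]| X => n Y.
rewrite -mulnn; clear; move=> B_gt0 le_n le_B D_gt0.
have : n * B <= 4 * (Delta * Delta) * Y by apply: leq_trans le_n _; nia.
have : 8 * (Delta * Delta) * Y <= B * Y by rewrite leq_mul2r le_B orbT.
move=> h1 h2; rewrite -(leq_pmul2r B_gt0); nia.
Qed.

(** Trial [i] is stage [i], owning its two rounds of slots and candidate [i]. A vertex unfixed at
    the end was unfixed before each trial and failed it. *)
Lemma card_unfixed v :
  #|[set y : Omega | ~~ abs_fixed y L v]| * 2 ^ L <= #|{: Omega}|.
Proof.
rewrite -[X in _ <= X]mul1n -{2}(exp1n L).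
pose bad i (y : Omega) :=
  (abs_fixed y i v == None) && ~~ trial_ok y i (abs_fixed y i) v.
apply: (@card_subpred _ _ _ (fun y : Omega => [forall i : 'I_L, bad i y])).
  move=> y unfixed; apply/forallP=> -[i iL] /=.
  have mono d j : ~~ abs_fixed y (d + j) v -> abs_fixed y j v = None.
    elim: d => [|d IH]; first by rewrite add0n; case: (abs_fixed y j v).
    by rewrite addSn /=; case: ifP.
  have unfixed_le j : j <= L -> abs_fixed y j v = None.
    by move=> jL; apply: (mono (L - j)); rewrite subnK.
  rewrite /bad unfixed_le ?eqxx /=; last exact: ltnW.
  by have := unfixed_le i.+1 iL; rewrite /=; case: ifP.
pose stage i (p : index) := match p with
  | inl (s, _) => (L + i.*2) * W <= s < (L + i.*2).+2 * W
  | inr (j, _) => j == i :> nat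
  end.
have stage_slot i t j : t < 4 * L * W ->
    stage i (inl (inord t, j)) = ((L + i.*2) * W <= t < (L + i.*2).+2 * W).
  by move=> lt_t; rewrite /stage inordK // ltnS ltnW.
have stage_cand i i' j : i' < L -> stage i (inr (inord i', j)) = (i' == i).
  by move=> lt_i; rewrite /stage inordK // ltnS ltnW.
have slots i : i < L -> (L + i.*2).+2 * W <= 4 * L * W.
  move=> iL; rewrite leq_mul2r; apply/orP; right.
  have : i.*2.+2 <= L.*2 by rewrite -doubleS leq_double.
  lia.
have before i j x y u : i <= j < L ->
    abs_fixed (resample (on_bits (stage j)) x y) i u = abs_fixed x i u.
  move=> /andP[ij jL]; have le_ij : (L + i.*2) * W <= (L + j.*2) * W.
    by rewrite leq_mul2r leq_add2l leq_double ij orbT.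
  have le_j : (L + j.*2) * W <= 4 * L * W.
    by apply: leq_trans (slots j jL); rewrite leq_mul2r -[_.+2]addn2 leq_addr orbT.
  apply: eq_abs_fixed => [w t lt_t|w i' lt_i'].
    have lt_tj := leq_trans lt_t le_ij.
    rewrite (@transmits_resample _ false) // => k.
    by rewrite stage_slot ?(leq_trans lt_tj le_j) // (leqNgt _ t) lt_tj.
  have lt_ij := leq_trans lt_i' ij.
  rewrite (@candidate_resample _ false) // => k.
  by rewrite stage_cand ?(ltn_trans lt_ij) // ltn_eqF.
apply: (card_stages (D := fun i => on_bits (stage i)) (bad := bad)).
  move=> i j x y /andP[ij jL]; rewrite /bad.
  have eqf u : abs_fixed (resample (on_bits (stage j)) x y) i u = abs_fixed x i u.
    by apply: before; rewrite ltnW.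
  have le_ij : (L + i.*2).+2 * W <= (L + j.*2) * W.
    by rewrite leq_mul2r -!addnS -doubleS leq_add2l leq_double ij orbT.
  rewrite eqf; have [|u|-> _ //] := @eq_trial_ok
      (resample (on_bits (stage j)) x y) x i _ _ v eqf.
    move=> w t /andP[_ lt_t]; have lt_tj := leq_trans lt_t le_ij.
    rewrite (@transmits_resample _ false) // => k.
    rewrite stage_slot ?(leq_trans lt_t (slots i (ltn_trans ij jL))) //.
    by rewrite (leqNgt _ t) lt_tj.
  rewrite (@candidate_resample _ false) // => k.
  by rewrite stage_cand ?(ltn_trans ij) // ltn_eqF.
(* Redrawing stage [i] does not change the colours fixed before it, so [abs_fixed x i] can serve as
   the constant [f] of [card_trial_fails]. *)
move=> i x iL; rewrite mul1n.
have eqf y u : abs_fixed (resample (on_bits (stage i)) x y) i u = abs_fixed x i u.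
  by apply: before; rewrite leqnn.
have [fv|fv] := eqVneq (abs_fixed x i v) None; last first.
  rewrite (_ : [set y | _] = set0) ?cards0 //; apply/setP=> y; rewrite !inE.
  by rewrite /bad eqf (negPf fv).
apply: card_subpred (card_trial_fails iL fv) => y /andP[_].
apply: contra => ok.
have [|u|-> _ //] := @eq_trial_ok
    (resample (on_bits (stage i)) x y) y i _ _ v (eqf y).
  move=> w t /andP[le_t lt_t].
  rewrite (@transmits_resample _ true) // => k.
  by rewrite stage_slot ?le_t // (leq_trans lt_t (slots i iL)).
by rewrite (@candidate_resample _ true) // => k; rewrite stage_cand // eqxx.
Qed.

Definition colouring_fails (y : Omega) : bool :=
  [|| ~~ injectiveb y,
      [exists (p | adj p.1 p.2), [forall i : 'I_L, p.2 \notin heard y i p.1]],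
      [exists (p | adj p.1 p.2),
         [forall i : 'I_L, p.2 \notin heard y (3 * L + i) p.1]] |
      [exists v, ~~ abs_fixed y L v]].

Lemma card_colouring_fails :
  #|[set y | colouring_fails y]| * 2 ^ L <= 4 * #|V| ^ 2 * #|{: Omega}|.
Proof.
set X := #|{: Omega}|; set n2 := #|V| ^ 2.
have card_pairs : #|[pred p : V * V | adj p.1 p.2]| <= n2.
  by rewrite /n2 -mulnn -card_prod max_card.
have -> : 4 * n2 * X = n2 * X + (n2 * X + (n2 * X + n2 * X)) by lia.
apply: card_or; last (apply: card_or; last apply: card_or).
(* The candidate colours alone give an identifier at least [L] bits, since [0 < b]. *)
- apply: leq_trans (card_non_injective V R); rewrite leq_mul2l leq_exp2l //.
  by rewrite /nbits card_sum !card_prod !card_ord; apply/orP; right; nia.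
- apply: leq_trans (leq_mul card_pairs (leqnn X)); apply: card_exists => -[v u] vu.
  by apply: (card_never_heard (q0 := 0)); rewrite // add0n leq_pmull.
- apply: leq_trans (leq_mul card_pairs (leqnn X)); apply: card_exists => -[v u] vu.
  by apply: card_never_heard; rewrite // addnC -mulSn.
apply: (@leq_trans (#|V| * X)).
  rewrite -[#|V|]/#|[pred v : V | true]|.
  by apply: card_exists => v _; apply: card_unfixed.
rewrite /n2 leq_mul2r; case: #|V| => [|m]; first by rewrite orbT.
by rewrite -mulnn leq_pmulr ?orbT.
Qed.

End Success.

(** * Assembling the simulation *)

Section Simulation.
Variables (I S : Type) (M : eqType) (K : finType) (T : nat).
Variables (A : local_alg I S M) (B0 : nocd_alg unit (K * {set K})).
Variables (V : finType) (adj : rel V) (inp : V -> I) (d : nat).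
Variable rnd : {ffun V -> {ffun 'I_(b_rbits B0) -> bool}}.
Hypotheses (A_wf : local_alg_wf A) (K_gt0 : 0 < #|K|).

Let col v := (nocd_output (B := B0) adj (fun=> tt) rnd v).1.
Let lis v := (nocd_output (B := B0) adj (fun=> tt) rnd v).2.
Local Notation B := (seq_alg B0 (sim_alg K T A)).

Lemma seq_sim_alg :
  (forall v u, adj v u -> col u \in lis v) ->
  (forall v, col v \notin lis v) ->
  (forall v, {in adj v &, injective col}) ->
  (forall v, #|lis v| <= d) ->
  [/\ forall v, nocd_output (B := B) adj inp rnd v = local_state adj A inp T v,
      nocd_time (B := B) adj inp rnd <= b_len B0 + T * #|K| &
      nocd_energy (B := B) adj inp rnd
        <= b_len B0 + local_energy adj A inp T * d.+1].
Proof.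
move=> nbr self inj le_d; split.
- move=> v; rewrite nocd_output_seq.
  exact: (sim_output T inp (info := nocd_output (B := B0) adj (fun=> tt) rnd)).
- exact: nocd_time_le.
apply: leq_trans (nocd_energy_seq _ _ _ _) _; rewrite leq_add2l.
exact: (sim_energy T inp (info := nocd_output (B := B0) adj (fun=> tt) rnd)).
Qed.
End Simulation.

Section Isolated.
Variables (I S : Type) (M : eqType) (A : local_alg I S M) (T : nat).

(** For Delta = 0 both budgets are 0, so no slot may be active; a LOCAL listener hears the empty
    multiset anyway. *)
Definition isolated_alg : nocd_alg I S :=
  @NocdAlg I S S unit 0 T (fun i _ => l_init A i) (fun _ _ => NIdle)
    (fun t s _ => l_upd A t s (if (l_act A t s).2 then Some [::] else None)) id.

Variables (V : finType) (adj : rel V) (inp : V -> I).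
Variable rnd : {ffun V -> {ffun 'I_0 -> bool}}.

Lemma isolated_output v : (forall v u, adj v u = false) ->
  nocd_output (B := isolated_alg) adj inp rnd v = local_state adj A inp T v.
Proof.
move=> no_adj; rewrite /nocd_output /=.
elim: T v => //= t IH v; rewrite IH /local_received; congr (l_upd _ _ _ _).
case: ifP => // _; congr Some.
by elim: (enum V) => //= u s <-; rewrite no_adj.
Qed.

Lemma isolated_time : nocd_time (B := isolated_alg) adj inp rnd = 0.
Proof. by apply: big1 => v _; apply: big_pred0. Qed.

Lemma isolated_energy : nocd_energy (B := isolated_alg) adj inp rnd = 0.
Proof. by apply: big1 => v _; rewrite count_pred0. Qed.
End Isolated.

(** For Delta = 1, log Delta = 0 leaves no budget for a setup phase. Colours are drawn without
    communication, and a vertex, ignorant of its neighbour's colour, listens to all colours but its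
    own. *)
Definition random_colour_alg (b : nat) :
    nocd_alg unit ({ffun 'I_b -> bool} * {set {ffun 'I_b -> bool}}) :=
  @NocdAlg unit _ {ffun 'I_b -> bool} unit b 0 (fun _ x => x)
    (fun _ _ => NIdle) (fun _ s _ => s) (fun s => (s, ~: [set s])).

(** With degrees at most 1, a vertex and its neighbours form a set closed under adjacency, which by
    connectivity is everything. *)
Lemma card_le2 (V : finType) (adj : rel V) :
  simple_graph adj -> graph_connected adj -> max_degree adj = 1 -> #|V| <= 2.
Proof.
move=> [adj_sym _] conn deg1.
have deg_le v : #|[set u | adj v u]| <= 1.
  by rewrite -deg1 (leq_bigmax (F := fun v => #|[set u | adj v u]|) v).
case: (pickP (mem V)) => [v _|V0]; last by rewrite eq_card0.
have clos x y : adj x y -> (x \in v |: [set u | adj v u])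
                         -> (y \in v |: [set u | adj v u]).
  rewrite !inE => xy /orP[/eqP <-|vx]; first by rewrite xy orbT.
  have /card_le1_eqP/(_ v y) := deg_le x.
  by rewrite !inE adj_sym vx xy => -> //; rewrite eqxx.
have closed_v : closed adj (mem (v |: [set u | adj v u])).
  by move=> x y xy; apply/idP/idP; apply: clos; rewrite // adj_sym.
have -> : #|V| = #|v |: [set u | adj v u]|.
  apply: eq_card => u; rewrite [LHS]/= -(closed_connect closed_v (conn v u)).
  by rewrite !inE eqxx.
by rewrite cardsU1; apply: leq_add (leq_b1 _) (deg_le v).
Qed.

Definition simulates (k c n Delta T : nat) (I S : Type) (M : eqType)
    (A : local_alg I S M) (B : nocd_alg I S) : Prop :=
  forall (V : finType) (adj : rel V),
    simple_graph adj -> graph_connected adj ->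
    #|V| = n -> max_degree adj = Delta ->
  forall (inp : V -> I) (E : nat),
    local_energy adj A inp T <= E ->
    @whp V (b_rbits B) n k (fun rnd =>
      (forall v : V, nocd_output adj inp rnd v = local_state adj A inp T v)
      /\ nocd_time adj inp rnd
           <= c * (Delta ^ 2 * T + Delta * log2 Delta * log2 n)
      /\ nocd_energy adj inp rnd
           <= c * (Delta * (E + log2 Delta * log2 n))).

Lemma degree_le (V : finType) (adj : rel V) v :
  #|[set u | adj v u]| <= max_degree adj.
Proof. exact: (leq_bigmax (F := fun v => #|[set u | adj v u]|) v). Qed.

Lemma whp_intro (V : finType) (R n k N : nat)
    (bad : pred {ffun V -> {ffun 'I_R -> bool}})
    (P : {ffun V -> {ffun 'I_R -> bool}} -> Prop) :
  0 < N ->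
  #|[set r | bad r]| * (n ^ k * N)
    <= N * #|{: {ffun V -> {ffun 'I_R -> bool}}}| ->
  (forall r, ~~ bad r -> P r) -> whp n k P.
Proof.
move=> N_gt0 le_bad goodP; exists [set r | ~~ bad r]; split; last first.
  by move=> r; rewrite inE; apply: goodP.
rewrite (_ : ~: _ = [set r | bad r]); last first.
  by apply/setP=> r; rewrite !inE negbK.
by rewrite -(leq_pmul2l N_gt0); apply: leq_trans le_bad; rewrite mulnC mulnA.
Qed.

(** * Maximum degree 0, 1 and at least 2 *)

Section Cases.
Variables (I S : Type) (M : eqType) (A : local_alg I S M).
Hypothesis A_wf : local_alg_wf A.

Lemma simulates_isolated k c n T :
  simulates k c n 0 T A (isolated_alg A T).
Proof.
move=> V adj _ _ _ deg0 inp E _.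
have no_adj v u : adj v u = false.
  have := degree_le adj v; rewrite deg0 leqn0 cards_eq0 => /eqP/setP/(_ u).
  by rewrite !inE.
apply: (whp_intro (N := 1) (bad := pred0)) => // [|r _].
  by rewrite (_ : [set _ | _] = set0) ?cards0 //; apply/setP=> r; rewrite !inE.
split; first by move=> v; apply: isolated_output.
by rewrite isolated_time isolated_energy.
Qed.

Lemma simulates_edge k c n T : 2 ^ k.+2 < c ->
  simulates k c n 1 T A
    (seq_alg (random_colour_alg k.+2) (sim_alg {ffun 'I_k.+2 -> bool} T A)).
Proof.
move=> lt_c V adj adj_simple conn cardV deg1 inp E le_E.
have n_le2 : n <= 2 by rewrite -cardV (card_le2 adj_simple).
have n_gt0 : 0 < n.
  rewrite -cardV lt0n; apply/eqP=> V0; move: deg1.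
  by rewrite /max_degree big1 // => v; have := card0_eq V0 v.
have cardK : #|{: {ffun 'I_k.+2 -> bool}}| = 2 ^ k.+2.
  by rewrite card_ffun card_bool card_ord.
have [adj_sym adj_irr] := adj_simple.
apply: (whp_intro (N := n ^ 2) (bad := fun r => ~~ injectiveb r)).
- by rewrite expn_gt0 n_gt0.
(* Two strings collide with probability at most n^2 / 2^(k+2), and n <= 2 gives n^(k+2) <=
   2^(k+2). *)
- rewrite -[n in X in _ <= X]cardV; apply: leq_trans (card_non_injective V k.+2).
  rewrite leq_mul2l -expnD addn2 /b_rbits /=; apply/orP; right.
  by rewrite leq_exp2r.
move=> r; rewrite negbK => /injectiveP r_inj.
have out v : nocd_output (B := random_colour_alg k.+2) adj (fun=> tt) r v
             = (r v, ~: [set r v]) by [].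
have [] := @seq_sim_alg I S M {ffun 'I_k.+2 -> bool} T A
  (random_colour_alg k.+2) V adj inp (2 ^ k.+2).-1 r A_wf.
- by rewrite cardK expn_gt0.
- move=> v u vu; rewrite !out !inE; apply: contraTneq vu => /r_inj ->.
  by rewrite adj_irr.
- by move=> v; rewrite out !inE eqxx.
- by move=> v u w _ _; rewrite !out /= => /r_inj.
- by move=> v; rewrite out -[#|_|]/#|~: [set r v]| cardsC1 cardK.
move=> ? le_time le_energy; split=> //.
rewrite cardK prednK ?expn_gt0 // !add0n in le_time le_energy.
have -> : log2 1 = 0 by [].
split.
  apply: leq_trans le_time _; rewrite exp1n !muln0 addn0 mul1n mulnC.
  by rewrite leq_mul2r (ltnW lt_c) orbT.
apply: leq_trans le_energy _; rewrite mul0n addn0 mul1n mulnC.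
by apply: leq_mul => //; apply: ltnW.
Qed.

(** From Delta < 2^(l+1) come 2 Delta <= 2^a and 8 Delta^2 <= 2^b. For the cost, 2l + 5 <= 7l gives
    W <= 56 Delta l, and L <= (2k+6) log n, so the 4L rounds take at most 224 (2k+6) Delta l log n
    slots; there are 2^b <= 32 Delta^2 colours. *)
Lemma simulates_large_degree k c n Delta T :
  224 * (2 * k + 6) <= c -> 1 < Delta ->
  let l := log2 Delta in
  let a := l + 2 in
  let b := 2 * l + 5 in
  let L := (log2 n).+1 * (k + 2) + 2 in
  let W := 2 ^ a.+1 * b in
  simulates k c n Delta T A
    (seq_alg (colouring_alg a b L W) (sim_alg (colour b) T A)).
Proof.
move=> le_c D_gt1 l a b L W V adj [adj_sym adj_irr] conn cardV degD inp E le_E.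
have D_gt0 : 0 < Delta by apply: ltnW.
have le_deg v : #|[set u | adj v u]| <= Delta by rewrite -degD degree_le.
have n_gt1 : 1 < n.
  have [v Dv] : exists v, Delta <= #|[set u | adj v u]|.
    apply/existsP; rewrite -[X in is_true X]negbK negb_exists; apply/negP.
    move=> /forallP lt_deg; have : max_degree adj <= Delta.-1.
      apply/bigmax_leqP => v _; have := lt_deg v; rewrite -ltnNge.
      by rewrite -{1}(prednK D_gt0).
    by rewrite degD -ltnS prednK // ltnn.
  by rewrite -cardV (leq_trans D_gt1) // (leq_trans Dv) // max_card.
have l_gt0 : 0 < l by rewrite /l /log2 trunc_log_gt0.
have n_log : 0 < log2 n by rewrite /log2 trunc_log_gt0.
have l_le : 2 ^ l <= Delta by apply: trunc_logP.
have lt_l : Delta < 2 ^ l.+1 by apply: trunc_log_ltn.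
have b_gt0 : 0 < b by rewrite /b addn_gt0 orbT.
have W_gt0 : 0 < W by rewrite muln_gt0 expn_gt0.
have le_a : 2 * Delta <= 2 ^ a.
  by rewrite /a addn2 expnS leq_mul2l ltnW.
have le_b : 8 * Delta ^ 2 <= 2 ^ b.
  have -> : b = 3 + (l.+1 * 2) by rewrite /b; lia.
  by rewrite expnD expnM leq_mul2l leq_exp2r // ltnW.
have le_L : n ^ k * (4 * n ^ 2) <= 2 ^ L.
  have -> : 2 ^ L = 4 * (2 ^ (log2 n).+1) ^ (k + 2).
    by rewrite /L addnC expnD expnM.
  rewrite mulnCA -expnD leq_mul2l /=.
  by rewrite leq_exp2r ?addn2 //; apply/ltnW/trunc_log_ltn.
have cardK : #|{: colour b}| = 2 ^ b.
  by rewrite card_ffun card_bool card_ord.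
have le_len : 4 * L * W <= c * (Delta * l * log2 n).
  have le_W : W <= 56 * (Delta * l).
    have -> : W = 8 * 2 ^ l * b by rewrite /W /a addn2 !expnS; lia.
    have -> : 56 * (Delta * l) = 8 * Delta * (7 * l) by lia.
    by apply: leq_mul; [rewrite leq_mul2l | rewrite /b; lia].
  have {}le_L : L <= (2 * k + 6) * log2 n by rewrite /L; nia.
  apply: leq_trans (leq_mul (leq_mul (leqnn 4) le_L) le_W) _.
  apply: leq_trans (leq_mul le_c (leqnn (Delta * l * log2 n))).
  by rewrite leq_eqVlt; apply/orP; left; apply/eqP; lia.
have le_K : #|{: colour b}| <= c * Delta ^ 2.
  rewrite cardK; have -> : b = 5 + (l * 2) by rewrite /b; lia.
  rewrite expnD expnM; apply: leq_mul; last by rewrite leq_exp2r.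
  by apply: leq_trans le_c; lia.
apply: (whp_intro (N := 4 * n ^ 2) (bad := @colouring_fails a b L W V adj)).
- by rewrite muln_gt0 expn_gt0 (ltnW n_gt1).
- have le_fails :=
    @card_colouring_fails a b L W V adj Delta adj_irr le_deg le_a erefl b_gt0 D_gt0 le_b.
  rewrite cardV in le_fails; apply: leq_trans le_fails.
  by rewrite leq_mul2l le_L orbT.
move=> r; rewrite /colouring_fails !negb_or negbK.
case/and4P=> /injectiveP r_inj /exists_inPn ids /exists_inPn cols /existsPn fix_all.
have learned v u : adj v u -> exists2 q, q < L & u \in heard adj r q v.
  move=> vu; have := ids (v, u) vu; rewrite negb_forall => /existsP[i].
  by rewrite negbK; exists i.
have learned_cols v u : adj v u ->
    exists2 q, 3 * L <= q < 4 * L & u \in heard adj r q v.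
  move=> vu; have := cols (v, u) vu; rewrite negb_forall => /existsP[i].
  rewrite negbK; exists (3 * L + i) => //.
  by rewrite leq_addr -[4]/(3 + 1) mulnDl mul1n ltn_add2l ltn_ord.
have all_fixed v : abs_fixed adj r L v by have := fix_all v; rewrite negbK.
have out := colouring_output W_gt0 r_inj learned all_fixed learned_cols.
have inj := @final_colour_inj a b L W V adj r all_fixed _ _ adj_sym.
have [] := @seq_sim_alg I S M (colour b) T A (colouring_alg a b L W) V adj
  inp Delta r A_wf.
- by rewrite cardK expn_gt0.
- by move=> v u vu; rewrite !out /=; apply: imset_f.
- move=> v; rewrite out /=; apply/imsetP=> -[u vu] eq_col.
  by have := vu; rewrite (inj v u _ eq_col) ?unfold_in ?adj_irr //; left.
- move=> v u w vu vw; rewrite !out /=; apply: inj; right; exists v => //.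
  by rewrite adj_sym.
- move=> v; rewrite out /=; apply: leq_trans (leq_imset_card _ _) _.
  by apply: leq_trans (le_deg v); rewrite cardsE.
move=> ? le_time le_energy; split=> //; split.
  apply: leq_trans le_time _; rewrite /= addnC mulnDr mulnA.
  by apply: leq_add le_len; rewrite mulnC leq_mul2r le_K orbT.
apply: leq_trans le_energy _; rewrite /= mulnDr addnC mulnDr [Delta * (l * _)]mulnA.
apply: leq_add le_len; rewrite mulnA mulnC.
have D_c : Delta.+1 <= c * Delta by nia.
exact: leq_mul.
Qed.
End Cases.

Theorem theorem3 :
  forall k : nat, exists c : nat,
  forall (I S : Type) (M : eqType) (n Delta T : nat) (A : local_alg I S M),
    local_alg_wf A ->
    exists B : nocd_alg I S,
    forall (V : finType) (adj : rel V),
      simple_graph adj -> graph_connected adj ->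
      #|V| = n -> max_degree adj = Delta ->
    forall (inp : V -> I) (E : nat),
      local_energy adj A inp T <= E ->
      @whp V (b_rbits B) n k (fun rnd =>
        (forall v : V, nocd_output adj inp rnd v = local_state adj A inp T v)
        /\ nocd_time adj inp rnd
             <= c * (Delta ^ 2 * T + Delta * log2 Delta * log2 n)
        /\ nocd_energy adj inp rnd
             <= c * (Delta * (E + log2 Delta * log2 n))).
Proof.
(* The first summand serves degree at least 2, the second degree 1. *)
move=> k; exists (224 * (2 * k + 6) + (2 ^ k.+2).+1).
move=> I S M n [|[|Delta]] T A A_wf; eexists.
- exact: simulates_isolated.
- by apply: simulates_edge => //; apply: leq_addl.
- by apply: simulates_large_degree => //; apply: leq_addr.
Qed.
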